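(* Let $A\in\mathbb{R}^{n\times m}$, $b\in\mathbb{R}^n$, $c\in\mathbb{R}^m_{>0}$, and consider the linear program: minimize $c^Tx$ subject to $Ax=b$, $x\ge 0$. Assume it is feasible, let $F$ be its set of feasible solutions, let $x^*$ be an optimal solution, and let $I\subseteq\{1,\dots,m\}$ be the union of the supports of all optimal solutions; assume $I\neq\emptyset$. Let $d\in\mathbb{R}^m_{>0}$, $D=\mathrm{diag}(d)$, $G=\{x\in\mathbb{R}^m : x>0\}$, and $x^0\in G$. Then the dynamics $$\dot{x}=D(q(x)-x),\qquad x(0)=x^0,$$ has a solution $x(t)\in G$ with $t\in[0,\infty)$. The solution satisfies: 1. $\inf_{t} x_i(t)>0$ for all $i\in I$; 2. $\mathrm{dist}(x(t),F)\to 0$ as $t\to\infty$; 3. $\lim_{t\to\infty}c^Tx(t)=c^Tx^*$.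
   Context: For $x\in\mathbb{R}^m$ with $x>0$ (all components positive), $q(x)$ denotes the minimum energy solution of $Af=b$, i.e. the unique minimizer $$q(x)=\mathrm{argmin}_{f\in\mathbb{R}^m}\Big\{\sum_{i=1}^m \frac{c_i}{x_i}f_i^2 : Af=b\Big\}.$$ The dot denotes the derivative with respect to time $t$. The support of a vector $v$ is $\mathrm{supp}(v)=\{i: v_i\ne 0\}$. $\mathrm{dist}(x,F)$ is the (Euclidean) distance from the point $x$ to the set $F$. *)

(* Defs.v *)
From mathcomp Require Import all_boot all_order all_algebra.
From mathcomp Require Import all_classical all_reals all_analysis.
Set Implicit Arguments.
Unset Strict Implicit.
Unset Printing Implicit Defensive.
Import Order.TTheory GRing.Theory Num.Theory.
Import numFieldNormedType.Exports.
Local Open Scope classical_set_scope.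
Local Open Scope ring_scope.

Definition pos_vec (R : realType) (m : nat) : set 'cV[R]_m :=
  [set x | forall i, 0 < x i 0].

Definition supp (R : realType) (m : nat) (v : 'cV[R]_m) : set 'I_m :=
  [set i | v i 0 != 0].

Definition dotv (R : realType) (m : nat) (u v : 'cV[R]_m) : R :=
  \sum_(i < m) u i 0 * v i 0.

(* The norm `|v| of the library on 'cV[R]_m is the sup norm. *)
Definition eucl_norm (R : realType) (m : nat) (v : 'cV[R]_m) : R :=
  Num.sqrt (\sum_(i < m) v i 0 ^+ 2).

Definition dist (R : realType) (m : nat) (x : 'cV[R]_m) (F : set 'cV[R]_m)
    : R :=
  inf [set eucl_norm (x - y) | y in F].

Definition feasible (R : realType) (n m : nat) (A : 'M[R]_(n, m))
    (b : 'cV[R]_n) : set 'cV[R]_m :=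
  [set x | A *m x = b /\ forall i, 0 <= x i 0].

Definition optimal (R : realType) (n m : nat) (A : 'M[R]_(n, m))
    (b : 'cV[R]_n) (c : 'cV[R]_m) : set 'cV[R]_m :=
  [set x | feasible A b x /\
           forall y, feasible A b y -> dotv c x <= dotv c y].

Definition opt_support (R : realType) (n m : nat) (A : 'M[R]_(n, m))
    (b : 'cV[R]_n) (c : 'cV[R]_m) : set 'I_m :=
  \bigcup_(x in optimal A b c) supp x.

Definition energy (R : realType) (m : nat) (c x f : 'cV[R]_m) : R :=
  \sum_(i < m) c i 0 / x i 0 * f i 0 ^+ 2.

Definition energy_minimizers (R : realType) (n m : nat) (A : 'M[R]_(n, m))
    (b : 'cV[R]_n) (c x : 'cV[R]_m) : set 'cV[R]_m :=
  [set f | A *m f = b /\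
           forall g, A *m g = b -> energy c x f <= energy c x g].

(* When c > 0, x > 0 and A f = b is solvable, the set of minimizers is a
   singleton and [xget] returns its element; the default value 0 is only used
   outside this case. *)
Definition min_energy_sol (R : realType) (n m : nat) (A : 'M[R]_(n, m))
    (b : 'cV[R]_n) (c x : 'cV[R]_m) : 'cV[R]_m :=
  xget 0 (energy_minimizers A b c x).

(* A trajectory on [0, +oo) is represented by a function on R whose values at
   negative times are irrelevant: the difference quotient at t only uses the
   increments h with t + h >= 0, so that it is the two-sided derivative for
   t > 0 and the right derivative for t = 0. *)
Definition has_derivative_nneg (R : realType) (m : nat) (x : R -> 'cV[R]_m)
    (t : R) (v : 'cV[R]_m) : Prop :=
  h^-1 *: (x (t + h) - x t) @[h --> within [set h | 0 <= t + h] 0^'] --> v.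

Definition dynamics_solution (R : realType) (n m : nat) (A : 'M[R]_(n, m))
    (b : 'cV[R]_n) (c d x0 : 'cV[R]_m) (x : R -> 'cV[R]_m) : Prop :=
  [/\ x 0 = x0,
      forall t, 0 <= t -> pos_vec (x t) &
      forall t, 0 <= t ->
        has_derivative_nneg x t
          (diag_mx d^T *m (min_energy_sol A b c (x t) - x t))].

(* Main.v *)
Require Import Defs.
From mathcomp Require Import all_boot all_order all_algebra.
From mathcomp Require Import all_classical all_reals all_analysis.
From mathcomp Require Import ring lra.
Import Order.TTheory GRing.Theory Num.Theory.
Import numFieldNormedType.Exports.
Local Open Scope classical_set_scope.
Local Open Scope ring_scope.

(* Let q = q(x), let u = c q / x = A^T p be the tensions, and let E = u . q be the
   energy. For each of the finitely many sign patterns of u fix one flow f with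
   A f = b, and for each pattern of q one potential difference A^T r, carrying that
   pattern. Pairing them with u, resp. q, gives |u| <= K E and |q| <= Q uniformly
   in x > 0.

   Existence: z = ln x satisfies z_i' = d_i (u_i / c_i - 1), whose right-hand side is
   locally Lipschitz. Clipping z to [-r(t), r(t)] gives a globally solvable equation.
   Its solutions satisfy e^{z_i} <= max(x_i(0), Q); for x* optimal, the sum of
   (c_i / d_i) x*_i z_i has derivative E - c^T x*, so z is at least linear in t from
   below on the support of x*, hence E <= M e^{al + be t}, hence |u| <= K E bounds the
   other coordinates. For a suitable r the clipping is therefore inactive.

   Asymptotics: let A^T p <= c with b^T p = c^T y be a dual certificate of an optimal
   y. Then W = sum (1/d_i) (c_i y_i ln x_i - (2 c_i - (A^T p)_i) x_i) satisfies
     W' = sum (c_i / x_i) (q_i - x_i)^2 + (c - A^T p)^T x >= 0.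
   As x is bounded, W is bounded above, and W >= W(0) keeps x_i away from 0 whenever
   y_i > 0. By Barbalat's argument b - A x and (c - A^T p)^T x tend to 0, hence so does
   c^T x - c^T y; compactness turns A x -> b into dist(x, F) -> 0. *)

Set Implicit Arguments.
Unset Strict Implicit.
Unset Printing Implicit Defensive.

(** * Solvability of weighted normal equations *)

Section LinearAlgebra.
Context {R : realType}.

Lemma trmx_mulE (m : nat) (u v : 'cV[R]_m) : (u^T *m v) 0 0 = dotv u v.
Proof. by rewrite mxE; apply: eq_bigr => i _; rewrite mxE. Qed.

Lemma dotv_trmul (n m : nat) (A : 'M[R]_(n, m)) (p : 'cV[R]_n) (f : 'cV[R]_m) :
  dotv (A^T *m p) f = dotv p (A *m f).
Proof. by rewrite -!trmx_mulE trmx_mul trmxK mulmxA. Qed.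

Lemma diag_mx_form (m : nat) (w : 'cV[R]_m) (z : 'rV[R]_m) :
  (z *m diag_mx w^T *m z^T) 0 0 = \sum_k w k 0 * z 0 k ^+ 2.
Proof.
rewrite mul_mx_diag mxE; apply: eq_bigr => k _.
by rewrite !mxE mulrAC expr2 mulrC.
Qed.

(** The left kernel of [M = A W A^T] lies in that of [A]: [v M = 0] forces
    [v M v^T = sum_k w_k (v A)_k^2 = 0]. By rank comparison the row space of [M] is that of [A^T],
    which contains [(A y)^T]. *)
Lemma normal_equation_solvable (n m : nat) (A : 'M[R]_(n, m)) (w y : 'cV[R]_m) :
  pos_vec w -> exists p : 'cV[R]_n, A *m (diag_mx w^T *m (A^T *m p)) = A *m y.
Proof.
move=> w0; pose M := A *m (diag_mx w^T *m A^T).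
have MT : M^T = M by rewrite /M !trmx_mul trmxK tr_diag_mx mulmxA.
have kerM : (kermx M <= kermx A)%MS.
  apply/row_subP => i; set v := row i _.
  have vM : v *m M = 0 by apply/sub_kermxP; exact: row_sub.
  apply/sub_kermxP; have := congr1 (fun N => (N *m v^T) 0 0) vM.
  rewrite mul0mx /M !mulmxA -[_ *m A^T *m v^T]mulmxA -trmx_mul.
  rewrite diag_mx_form mxE => /eqP; rewrite psumr_eq0 => [/allP z0|k _].
    apply/rowP => k; rewrite [RHS]mxE.
    have := z0 k (mem_index_enum _).
    by rewrite mulf_eq0 (gt_eqF (w0 _)) sqrf_eq0 => /eqP.
  by rewrite mulr_ge0 ?sqr_ge0// ltW.
have sub : (M <= A^T)%MS by rewrite /M mulmxA submxMl.
have rk : (\rank A^T <= \rank M)%N.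
  rewrite mxrank_tr.
  have := mxrankS kerM; rewrite !mxrank_ker => h.
  by rewrite -(leq_sub2lE (m := n)) ?rank_leq_row.
have : ((A *m y)^T <= M)%MS.
  rewrite trmx_mul; apply: submx_trans (submxMl _ _) _.
  have /leqifP := mxrank_leqif_sup sub; case: ifP => // _.
  by rewrite ltnNge rk.
move=> /submxP[p /(congr1 trmx)]; rewrite trmxK trmx_mul MT => yp.
by exists p^T; rewrite yp /M !mulmxA.
Qed.

End LinearAlgebra.

(** * Minimum energy flows and their tensions *)

Section MinimumEnergy.
Context {R : realType} {n m : nat} (A : 'M[R]_(n, m)) (c : 'cV[R]_m).
Hypothesis c0 : pos_vec c.

(** Ohm's law: with resistance [c i / x i], this is the potential drop along coordinate [i]. *)
Definition tension (x q : 'cV[R]_m) : 'cV[R]_m :=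
  \col_i (c i 0 / x i 0 * q i 0).

Lemma energy_tension (x f : 'cV[R]_m) :
  energy c x f = dotv (tension x f) f.
Proof. by apply: eq_bigr => i _; rewrite mxE expr2 mulrA. Qed.

Lemma energyD (x f h : 'cV[R]_m) :
  energy c x (f + h) =
  energy c x f + energy c x h + dotv (tension x f) h *+ 2.
Proof.
rewrite /energy /dotv -mulr_natr mulr_suml -!big_split /=.
by apply: eq_bigr => i _; rewrite !mxE; ring.
Qed.

Lemma energy_ge0 (x f : 'cV[R]_m) : pos_vec x -> 0 <= energy c x f.
Proof.
move=> x0; apply: sumr_ge0 => i _.
by rewrite mulr_ge0 ?sqr_ge0// ltW// divr_gt0.
Qed.

Lemma energy_eq0 (x f : 'cV[R]_m) : pos_vec x -> energy c x f = 0 -> f = 0.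
Proof.
move=> x0 /eqP; rewrite psumr_eq0 => [/allP h|i _]; last first.
  by rewrite mulr_ge0 ?sqr_ge0// ltW// divr_gt0.
apply/colP => i; have := h i (mem_index_enum _).
by rewrite mulf_eq0 gt_eqF ?divr_gt0//= sqrf_eq0 mxE => /eqP.
Qed.

(** The flow [f = W A^T p] from the normal equation with [W = diag(x/c)] has tension [A^T p],
    orthogonal to [ker A]. So the cross term of [energyD] vanishes for every competitor, [f] is the
    strict minimizer, and the [xget] value must be [f]. Writing the right-hand side as [A *m y]
    builds in solvability. *)
Lemma min_energy_solP (x y : 'cV[R]_m) : pos_vec x ->
  let q := min_energy_sol A (A *m y) c x in
  A *m q = A *m y /\ exists p, tension x q = A^T *m p.
Proof.
move=> x0 q.
have w0 : pos_vec (\col_i (x i 0 / c i 0) : 'cV[R]_m).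
  by move=> i; rewrite mxE divr_gt0.
have [p Ap] := normal_equation_solvable A y w0.
set f : 'cV[R]_m := diag_mx _ *m _ in Ap.
have tf : tension x f = A^T *m p.
  apply/colP => i; rewrite /f mul_diag_mx !mxE mulrA.
  rewrite (_ : _ / _ * _ = 1) ?mul1r//.
  by field; rewrite !gt_eqF.
have fmin g : A *m g = A *m y ->
    energy c x g = energy c x f + energy c x (g - f).
  move=> Ag; rewrite -{1}(subrK f g) [g - f + f]addrC energyD tf dotv_trmul.
  rewrite mulmxBr Ag Ap subrr (_ : dotv p 0 = 0) ?mul0rn ?addr0//.
  by rewrite /dotv big1// => i _; rewrite mxE mulr0.
have : energy_minimizers A (A *m y) c x q.
  apply: xgetPex; exists f; split=> // g Ag.
  by rewrite (fmin _ Ag) lerDl energy_ge0.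
move=> [Aq qmin]; split=> //; exists p.
suff -> : q = f by [].
apply/eqP; rewrite -subr_eq0; apply/eqP; apply: (energy_eq0 x0).
apply/eqP; rewrite eq_le energy_ge0// andbT.
by have := qmin f Ap; rewrite (fmin _ Aq) gerDl.
Qed.

End MinimumEnergy.

(** * Conformal representatives of sign patterns *)

Section SignPatterns.
Context {R : realType}.

(* There are finitely many sign patterns, so one representative of each suffices. *)
Lemma conformal_representatives (m : nat) (P : set 'cV[R]_m) :
  exists2 K : R, 0 <= K & forall v, P v -> exists f, [/\ P f,
    forall i, f i 0 * v i 0 = `|f i 0| * `|v i 0|,
    forall i, `|v i 0| <= K * (`|f i 0| * `|v i 0|) &
    forall i, `|f i 0| <= K].
Proof.
pose pat (v : 'cV[R]_m) : {ffun 'I_m -> bool * bool} :=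
  [ffun i => (0 < v i 0, v i 0 < 0)].
pose rep s := xget 0 [set f | P f /\ pat f = s].
(* The inverses give [K |f_i| >= 1] on nonzero entries, the other summands give [|f_i| <= K]. *)
pose K : R := \sum_s \sum_i (`|rep s i 0|^-1 + `|rep s i 0|).
have KD s i : `|rep s i 0|^-1 + `|rep s i 0| <= K.
  rewrite /K (bigD1 s) //= (bigD1 i) //= -addrA lerDl.
  by rewrite addr_ge0// sumr_ge0// => *; rewrite ?sumr_ge0// => *; rewrite addr_ge0.
exists K => [|v Pv].
  by rewrite /K !sumr_ge0// => *; rewrite sumr_ge0// => *; rewrite addr_ge0.
exists (rep (pat v)).
have [Pf patf] : P (rep (pat v)) /\ pat (rep (pat v)) = pat v.
  by apply: (@xgetPex _ 0 [set f | P f /\ pat f = pat v]); exists v.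
have sgn i : (0 < rep (pat v) i 0) = (0 < v i 0) /\
             (rep (pat v) i 0 < 0) = (v i 0 < 0).
  by have /ffunP/(_ i) := patf; rewrite !ffunE => -[-> ->].
split=> // i.
- have [] := sgn i.
  case: (ltrgtP (v i 0) 0) => [v0 _ f0|v0 f0 _|-> _ _]; last by rewrite normr0 !mulr0.
    by rewrite (ltr0_norm v0) (ltr0_norm (f0 : is_true _)) mulrNN.
  by rewrite (gtr0_norm v0) (gtr0_norm (f0 : is_true _)).
- have [s1 s2] := sgn i.
  have [vi0|vi0] := eqVneq (v i 0) 0.
    by rewrite vi0 normr0 !mulr0.
  have f0 : rep (pat v) i 0 != 0 by move: vi0; rewrite !neq_lt s1 s2.
  rewrite mulrA ler_peMl// -[leLHS](mulVf (x := `|rep (pat v) i 0|)) ?normr_eq0//.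
  by rewrite ler_wpM2r//; apply: le_trans (KD (pat v) i); rewrite lerDl.
- by apply: le_trans (KD (pat v) i); rewrite lerDr invr_ge0.
Qed.

End SignPatterns.

(** * Bounds on tensions and flows, uniform in [x] *)

Section EnergyBounds.
Context {R : realType} {n m : nat} (A : 'M[R]_(n, m)) (c y : 'cV[R]_m).
Hypothesis c0 : pos_vec c.
Let q x := min_energy_sol A (A *m y) c x.

(** The tension of [q x] has the form [A^T p], so its pairing with [f] depends only on [A f]. *)
Lemma energy_min_energy_sol (x f : 'cV[R]_m) : pos_vec x -> A *m f = A *m y ->
  energy c x (q x) = dotv (tension c x (q x)) f.
Proof.
move=> x0 Af; have [Aq [p tp]] := min_energy_solP A c0 y x0.
by rewrite energy_tension tp !dotv_trmul Af Aq.
Qed.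

Lemma energy_min_energy_sol_le (x f : 'cV[R]_m) : pos_vec x ->
  A *m f = A *m y -> energy c x (q x) <= energy c x f.
Proof.
move=> x0 Af; have [Aq [p tp]] := min_energy_solP A c0 y x0.
rewrite -[f](subrK (q x)) [f - _ + _]addrC energyD tp dotv_trmul mulmxBr Af Aq.
rewrite subrr (_ : dotv p 0 = 0) ?mul0rn ?addr0 ?lerDl ?energy_ge0//.
by rewrite /dotv big1// => i _; rewrite mxE mulr0.
Qed.

(** Take a flow [f] conformal to [q], hence to [u], as [c/x > 0]. The energy is then
    [u . f = sum_j |u_j| |f_j|] without cancellation, and [K] times the summand [i] already
    dominates [|u_i|]. *)
Lemma tension_le_energy : exists2 K : R, 0 <= K &
  forall x, pos_vec x -> forall i,
    `|tension c x (q x) i 0| <= K * energy c x (q x).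
Proof.
have [K K0 KP] := conformal_representatives [set f : 'cV[R]_m | A *m f = A *m y].
exists K => // x x0 i; set u := tension c x (q x).
have [f [Af fu Kf _]] : exists f, [/\ A *m f = A *m y,
    forall i, f i 0 * u i 0 = `|f i 0| * `|u i 0| ,
    forall i, `|u i 0| <= K * (`|f i 0| * `|u i 0|) & True].
  have [Aq _] := min_energy_solP A c0 y x0.
  have [f [Af fq Kf _]] := KP _ Aq.
  exists f; split=> // j; rewrite /u mxE normrM.
    have cx : 0 < c j 0 / x j 0 by rewrite divr_gt0.
    by rewrite gtr0_norm// !(mulrCA _ (c j 0 / _)) fq.
  by rewrite !(mulrCA _ `|c j 0 / _|) ler_wpM2l.
apply: le_trans (Kf i) _; rewrite ler_wpM2l// (energy_min_energy_sol x0 Af).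
have uf j : u j 0 * f j 0 = `|f j 0| * `|u j 0| by rewrite mulrC.
rewrite /dotv -/u (bigD1 i) //= uf lerDl sumr_ge0// => j _.
by rewrite uf mulr_ge0.
Qed.

(** Dual to the previous bound: a potential difference [v = A^T p] conformal to the tension is
    conformal to [q], and [sum_j |v_j| |q_j| = v . q = v . y] is at most [sum_j K |y_j|], whatever
    [x] is. *)
Lemma min_energy_sol_bounded : exists2 Q : R, 0 < Q &
  forall x, pos_vec x -> forall i, `|q x i 0| <= Q.
Proof.
have [K K0 KP] := conformal_representatives
  [set u : 'cV[R]_m | exists p, u = A^T *m p].
pose Y : R := \sum_i `|y i 0| * K.
have Y0 : 0 <= Y by apply: sumr_ge0 => i _; rewrite mulr_ge0.
exists (K * Y + 1) => [|x x0 i]; first by rewrite ltr_wpDl// mulr_ge0.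
have [Aq qp] := min_energy_solP A c0 y x0.
have [v [[p vE] vu Kv vK]] := KP _ qp.
have xc j : q x j 0 = x j 0 / c j 0 * tension c x (q x) j 0.
  by rewrite mxE; field; rewrite !gt_eqF.
have xc0 j : 0 < x j 0 / c j 0 by rewrite divr_gt0.
have vq j : v j 0 * q x j 0 = `|v j 0| * `|q x j 0|.
  by rewrite xc normrM (gtr0_norm (xc0 j)) !(mulrCA _ (x j 0 / _)) vu.
apply: (@le_trans _ _ (K * (`|v i 0| * `|q x i 0|))).
  by rewrite xc normrM !(mulrCA _ `|x i 0 / _|) ler_wpM2l.
rewrite ler_wpDr// ler_wpM2l//.
apply: (@le_trans _ _ (dotv v (q x))).
  rewrite /dotv (bigD1 i) //= vq lerDl sumr_ge0// => j _.
  by rewrite vq mulr_ge0.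
rewrite vE dotv_trmul Aq -dotv_trmul -vE; apply: ler_sum => j _.
apply: le_trans (ler_norm _) _; rewrite normrM mulrC ler_wpM2l//.
Qed.

End EnergyBounds.

(** * Farkas' alternative for finitely generated cones *)

Section Farkas.
Context {R : realFieldType} {n : nat}.
Implicit Types (v b p : 'rV[R]_n) (s : seq 'rV[R]_n).

Definition dotr (u v : 'rV[R]_n) : R := (u *m v^T) 0 0.

Lemma dotrZl a (u v : 'rV[R]_n) : dotr (a *: u) v = a * dotr u v.
Proof. by rewrite /dotr -scalemxAl mxE. Qed.
Lemma dotrZr a (u v : 'rV[R]_n) : dotr u (a *: v) = a * dotr u v.
Proof. by rewrite /dotr linearZ -scalemxAr mxE. Qed.
Lemma dotrBl (u u' v : 'rV[R]_n) : dotr (u - u') v = dotr u v - dotr u' v.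
Proof. by rewrite /dotr mulmxBl !mxE. Qed.
Lemma dotrBr (u v v' : 'rV[R]_n) : dotr u (v - v') = dotr u v - dotr u v'.
Proof. by rewrite /dotr linearB mulmxBr !mxE. Qed.

Inductive cone : seq 'rV[R]_n -> 'rV[R]_n -> Prop :=
| cone_nil : cone [::] 0
| cone_cons a s t v : 0 <= t -> cone s v -> cone (a :: s) (t *: a + v).

(** Induction on the number of generators. If [p] separates [b] from the cone of [s] but
    [dotr p a < 0], everything is projected along [a] onto the hyperplane [p = 0], and the induction
    hypothesis is applied there. *)
Lemma farkas_alternative s b :
  cone s b \/ exists p, (forall a, a \in s -> 0 <= dotr p a) /\ dotr p b < 0.
Proof.
move: {2}(size s) (erefl (size s)) => k; elim: k s b => [|k IH] [|a s] b //= sk.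
  have [->|b0] := eqVneq b 0; first by left; constructor.
  right; exists (- b); split=> //.
  have : exists i, b 0 i != 0.
    apply/existsP; rewrite -negb_forall; apply: contra b0 => /forallP h.
    by apply/eqP/rowP => i; rewrite mxE; apply/eqP.
  move=> [i bi]; rewrite /dotr mulNmx mxE oppr_lt0 mxE (bigD1 i) //=.
  rewrite !mxE -expr2 ltr_wpDr//; last by rewrite exprn_even_gt0.
  by apply: sumr_ge0 => j _; rewrite mxE -expr2 sqr_ge0.
have {}sk : size s = k by case: sk.
have [sb|[p [ps pb]]] := IH s b sk.
  by left; rewrite -[b]add0r -[0](scale0r a); constructor.
have [pa|pa] := leP 0 (dotr p a).
  by right; exists p; split=> // x; rewrite inE => /predU1P[->|/ps].
(* This is [- dotr p a > 0] times the projection of [x] along [a] onto the kernel of [p]. *)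
pose proj x := dotr p x *: a - dotr p a *: x.
have [|[p' [p's p'b]]] := IH _ (proj b) (etrans (size_map proj s) sk).
  (* A conic combination of projections lifts to a conic combination [w] of the generators; [t]
     collects the multiples of [a] and is nonnegative because [p] is nonnegative on [s]. *)
  have lift r v : cone r v -> forall r', r = [seq proj x | x <- r'] ->
      (forall x, x \in r' -> 0 <= dotr p x) ->
      exists t w, [/\ 0 <= t, cone r' w & v = t *: a - dotr p a *: w].
    elim=> [|x {}r t {}v t0 _ IHr] [|x' r'] //=.
      by exists 0, 0; split=> //; [constructor|rewrite scale0r scaler0 subrr].
    move=> [xE rE] pos.
    have [||t' [w [t'0 rw vE]]] := IHr r' => //.
      by move=> z zr; apply: pos; rewrite inE zr orbT.
    exists (t * dotr p x' + t'), (t *: x' + w); split.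
    - by rewrite addr_ge0// mulr_ge0// pos ?mem_head.
    - by constructor.
    - rewrite xE vE /proj scalerBr scalerDl !scalerA scalerDr opprD !scalerA.
      by rewrite [dotr p a * t]mulrC addrACA.
  move=> /lift /(_ _ erefl ps) [t [w [t0 sw]]].
  rewrite /proj => /eqP; rewrite subr_eq => /eqP E.
  left.
  have -> : b = ((t - dotr p b) / - dotr p a) *: a + w.
    have pa0 : dotr p a != 0 by rewrite lt_eqF.
    apply: (scalerI pa0); rewrite scalerDr scalerA.
    rewrite (_ : _ * _ = dotr p b - t); last by field; rewrite ?oppr_eq0.
    by rewrite scalerBl E [t *: a - _]addrC [_ + _ + dotr p a *: b]addrAC addrK addrAC addNr add0r.
  by constructor=> //; rewrite divr_ge0// ?subr_ge0 ?oppr_ge0 ltW// (lt_le_trans pb).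
(* This functional is [p'] composed with [proj], hence zero on [a]. *)
right; exists (dotr p' a *: p - dotr p a *: p').
have pp x : dotr (dotr p' a *: p - dotr p a *: p') x = dotr p' (proj x).
  by rewrite dotrBl !dotrZl dotrBr !dotrZr mulrC.
split=> [x|]; last by rewrite pp.
rewrite inE pp => /predU1P[->|xs].
  by rewrite dotrBr !dotrZr subrr.
by apply: p's; apply: map_f.
Qed.

End Farkas.

(** * Dual certificates of the linear program *)

Section Duality.
Context {R : realType}.

Lemma cone_map_sum (n : nat) (I : eqType) (f : I -> 'rV[R]_n) (l : seq I) v :
  uniq l -> cone [seq f i | i <- l] v ->
  exists2 x : I -> R, forall i, 0 <= x i & v = \sum_(i <- l) x i *: f i.
Proof.
elim: l v => [|i l IH] v /=.
  by move=> _ H; inversion H; exists (fun=> 0) => //; rewrite big_nil.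
move=> /andP[il ul] H; inversion H as [|a s t w t0 lw E1 E2].
have [x x0 wE] := IH _ ul lw.
exists (fun j => if j == i then t else x j) => [j|]; first by case: ifP.
rewrite big_cons eqxx wE; congr (_ + _).
apply: eq_big_seq => j jl.
by case: eqP => // ji; rewrite -ji jl in il.
Qed.

Lemma mulmx_colsum (n m : nat) (A : 'M[R]_(n, m)) (x : 'cV[R]_m) :
  (A *m x)^T = \sum_i x i 0 *: (col i A)^T.
Proof.
apply/rowP => k; rewrite summxE !mxE; apply: eq_bigr => i _.
by rewrite !mxE mulrC.
Qed.

(** Farkas for the generators [-(b, opt)] and [(A_i, c_i)] and the target [(0, -1)]. Reaching the
    target gives [A X = t b] and [c . X = t opt - 1] with [X, t >= 0]; then [X / t] is feasible and
    cheaper than the optimum. A separating [(p, tau)] has [tau > 0] and yields the dual point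
    [- p / tau]. *)
Lemma lp_dual_certificate (n m : nat) (A : 'M[R]_(n, m)) (b : 'cV[R]_n)
    (c xstar : 'cV[R]_m) : pos_vec c -> optimal A b c xstar ->
  exists p : 'cV[R]_n, (forall i, (A^T *m p) i 0 <= c i 0) /\
                       dotv p b = dotv c xstar.
Proof.
move=> c0 [[Ax xs0] xopt]; set opt := dotv c xstar.
pose C i : 'rV[R]_(n + 1) := row_mx (col i A)^T (c i 0)%:M.
pose B : 'rV[R]_(n + 1) := row_mx b^T opt%:M.
case: (farkas_alternative (- B :: [seq C i | i <- index_enum 'I_m]) (row_mx 0 (- 1)%:M)).
  move=> H; inversion H as [|a s t w t0 Cw E1 E2].
  have [x x0 wE] := cone_map_sum (index_enum_uniq _) Cw.
  pose X : 'cV[R]_m := \col_i x i.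
  have {}wE : w = row_mx (A *m X)^T (dotv c X)%:M.
    rewrite wE mulmx_colsum; apply/rowP => k.
    rewrite summxE -(splitK k); case: (fintype.split k) => j /=.
      rewrite row_mxEl summxE; apply: eq_bigr => i _.
      by rewrite mxE row_mxEl !mxE.
    rewrite row_mxEr (ord1 j) mxE eqxx mulr1n /dotv; apply: eq_bigr => i _.
    by rewrite mxE row_mxEr !mxE eqxx mulr1n mulrC.
  move: E2; rewrite wE /B scalerN scale_row_mx opp_row_mx add_row_mx.
  move=> /eq_row_mx[/eqP]; rewrite addrC subr_eq0 => /eqP AX /matrixP/(_ 0 0).
  rewrite !mxE !mulr1n => cX.
  have X0 i : 0 <= X i 0 by rewrite mxE.
  have cX0 : 0 <= dotv c X by apply: sumr_ge0 => i _; rewrite mulr_ge0// ltW.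
  (* If [t = 0] the cost of [X] would be -1, against [c > 0]. *)
  have [t00|tn0] := eqVneq t 0; first by exfalso; move: cX; rewrite t00; lra.
  have tp : 0 < t by rewrite lt_neqAle eq_sym tn0.
  have : opt <= dotv c (t^-1 *: X).
    apply: xopt; split=> [|i]; last by rewrite mxE mulr_ge0// invr_ge0.
    rewrite -scalemxAr -[A *m X]trmxK AX linearZ /= trmxK scalerA mulVf//.
    by rewrite scale1r.
  have -> : dotv c (t^-1 *: X) = t^-1 * dotv c X.
    by rewrite /dotv mulr_sumr; apply: eq_bigr => i _; rewrite mxE mulrCA.
  rewrite -(ler_pM2l tp) mulrA mulfV// mul1r => h.
  by exfalso; move: cX h; lra.
move=> [P [Ps Pb]].
set p := lsubmx P; set tau := rsubmx P 0 0.
have PE (u : 'rV[R]_n) (a : R) : dotr P (row_mx u a%:M) = (p *m u^T) 0 0 + tau * a.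
  rewrite /dotr -{1}(hsubmxK P) tr_row_mx mul_row_col mxE; congr (_ + _).
  by rewrite mxE big_ord_recl big_ord0 addr0 ![a%:M^T _ _]mxE ![a%:M _ _]mxE mulr1n.
have tau0 : 0 < tau.
  move: Pb; rewrite PE trmx0 mulmx0 mxE add0r mulrN1; lra.
have PC i : 0 <= (p *m col i A) 0 0 + tau * c i 0.
  rewrite -[col i A]trmxK -PE; apply: Ps.
  by rewrite inE; apply/orP; right; apply: map_f; exact: mem_index_enum.
have PB : (p *m b) 0 0 + tau * opt <= 0.
  have := Ps (- B) (mem_head _ _); rewrite -scaleN1r dotrZr PE trmxK; lra.
have ApE i : (A^T *m (- tau^-1 *: p^T)) i 0 = - tau^-1 * (p *m col i A) 0 0.
  rewrite -scalemxAr mxE; congr (_ * _); rewrite !mxE; apply: eq_bigr => k _.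
  by rewrite !mxE mulrC.
exists (- tau^-1 *: p^T).
have le_c i : (A^T *m (- tau^-1 *: p^T)) i 0 <= c i 0.
  rewrite ApE mulNr -mulrN ler_pdivrMl//; have := PC i; lra.
(* Weak duality against [xstar] gives one inequality, nonnegativity on [- B] the other. *)
split=> //; apply/eqP; rewrite eq_le; apply/andP; split.
  rewrite -Ax -dotv_trmul; apply: ler_sum => i _.
  by rewrite ler_wpM2r.
rewrite -trmx_mulE linearZ /= trmxK -scalemxAl mxE mulNr -mulrN ler_pdivlMl//.
move: PB; lra.
Qed.

End Duality.

(** * Mean value estimates, Barbalat's argument, primitives, geometric limits *)

Section Calculus.
Context {R : realType}.
Implicit Types f W : R -> R.

Lemma mvt_bounds f (df : R -> R) (a b : R) : a <= b -> continuous f ->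
  (forall t : R, a < t -> t < b -> is_derive t (1 : R) f (df t)) ->
  a = b \/ exists t, [/\ a < t, t < b & f b - f a = df t * (b - a)].
Proof.
rewrite le_eqVlt => /predU1P[->|ab] fc fd; first by left.
have [|t tab E] := MVT ab _ (continuous_subspaceT fc) (df := df).
  by move=> t; rewrite in_itv /= => /andP[at_ tb]; exact: fd.
by right; exists t; move: tab; rewrite in_itv /= => /andP[].
Qed.

Lemma mvt_ge f (df : R -> R) (a b k : R) : a <= b -> continuous f ->
  (forall t : R, a < t -> t < b -> is_derive t (1 : R) f (df t)) ->
  (forall t : R, a < t -> t < b -> k <= df t) -> k * (b - a) <= f b - f a.
Proof.
move=> ab fc fd fk; have [->|[t [at_ tb ->]]] := mvt_bounds ab fc fd.
  by rewrite !subrr mulr0.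
by rewrite ler_wpM2r ?subr_ge0// fk.
Qed.

Lemma mvt_le f (df : R -> R) (a b k : R) : a <= b -> continuous f ->
  (forall t : R, a < t -> t < b -> is_derive t (1 : R) f (df t)) ->
  (forall t : R, a < t -> t < b -> df t <= k) -> f b - f a <= k * (b - a).
Proof.
move=> ab fc fd fk; have [->|[t [at_ tb ->]]] := mvt_bounds ab fc fd.
  by rewrite !subrr mulr0.
by rewrite ler_wpM2r ?subr_ge0// fk.
Qed.

(** Let [s] be the last time up to [t] with [f <= B]. After it the derivative is nonpositive, so
    [f t <= f s <= B]. *)
Lemma barrier_le f (df : R -> R) (B : R) : continuous f ->
  (forall t : R, 0 < t -> is_derive t (1 : R) f (df t)) -> f 0 <= B ->
  (forall t, 0 < t -> B < f t -> df t <= 0) ->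
  forall t, 0 <= t -> f t <= B.
Proof.
move=> fc fd f0 fB t t0; rewrite leNgt; apply/negP => Bt.
pose S := [set s | [/\ 0 <= s, s <= t & f s <= B]].
have S0 : S 0 by split.
have hS : has_sup S by split; [exists 0 | exists t => s []].
pose s := sup S.
have s0 : 0 <= s by apply: ub_le_sup => //; exact: hS.2.
have st : s <= t by apply: ge_sup => [|r []]; first by exists 0.
have after r : s < r -> r <= t -> B < f r.
  move=> sr rt; rewrite ltNge; apply/negP => frB.
  have : r <= s by apply: ub_le_sup; [exact: hS.2|split=> //; lra].
  lra.
have fs : f s <= B.
  rewrite leNgt; apply/negP => Bs.
  have /nbhs_ballP[e /= e0 he] : \forall r \near s, B < f r.
    exact: (cvgr_gt (f s) (fc s)).
  have [r Sr rs] := sup_adherent e0 hS.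
  have rs' : r <= s by apply: ub_le_sup => //; exact: hS.2.
  have : B < f r.
    apply: he; rewrite /ball /= ger0_norm ?subr_ge0//; move: rs; rewrite -/s; lra.
  by rewrite ltNge; case: Sr => _ _ ->.
suff : f t - f s <= 0 * (t - s) by lra.
apply: (mvt_le (df := df)) => // r sr rt; first by apply: fd; lra.
by apply: fB; [lra|apply: after; lra].
Qed.

(* Barbalat's argument: a Lipschitz [f] that stays away from 0 infinitely often
   would make [W] increase by a fixed amount infinitely often. *)
Lemma lipschitz_dissipation_cvg0 f W (dW : R -> R) (L M : R) :
  continuous W -> (forall t : R, 0 < t -> is_derive t (1 : R) W (dW t)) ->
  (forall t, 0 < t -> 0 <= dW t) -> (forall t, 0 <= t -> W t <= M) ->
  (forall s t : R, 0 <= s -> s <= t -> `|f t - f s| <= L * (t - s)) ->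
  (forall e, 0 < e -> exists2 eta, 0 < eta &
     forall t, 0 < t -> e <= `|f t| -> eta <= dW t) ->
  f t @[t --> +oo] --> (0 : R).
Proof.
move=> Wc Wd dW0 WM fL fe.
have Wnd s t : 0 <= s -> s <= t -> W s <= W t.
  move=> s0 st; suff : 0 * (t - s) <= W t - W s by lra.
  by apply: (mvt_ge (df := dW)) => // r sr rt; [apply: Wd|apply: dW0]; lra.
have [K K0 fK] : exists2 K, 0 < K &
    forall s t : R, 0 <= s -> s <= t -> `|f t - f s| <= K * (t - s).
  exists (`|L| + 1) => [|s t s0 st]; first by rewrite ltr_wpDl.
  apply: le_trans (fL _ _ s0 st) _; rewrite ler_wpM2r ?subr_ge0//.
  by rewrite ler_wpDr// ler_norm.
apply/cvgrPdist_lt => e e0.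
have [eta eta0 He] := fe (e / 2) ltac:(by rewrite divr_gt0).
(* Within time [de] the [K]-Lipschitz [f] moves by at most [e / 2], so [|f|] stays above [e / 2] and
   [W] gains at least [eta * de]. *)
pose de := e / 2 / K.
have de0 : 0 < de by rewrite !divr_gt0.
pose S := [set W t | t in [set t | 0 <= t]].
have hS : has_sup S.
  split; first by exists (W 0); exists 0 => /=.
  by exists M => _ [t t0 <-]; exact: WM.
(* From [T] on, [W] can gain only less than [eta * de]. *)
have [_ [T T0 <-] WT] := sup_adherent (mulr_gt0 eta0 de0) hS.
exists T; split; first by rewrite num_real.
move=> t Tt; rewrite sub0r normrN ltNge; apply/negP => eft.
move: T0 => /= T0.
have t0 : 0 <= t by lra.
have : eta * (t + de - t) <= W (t + de) - W t.
  apply: (mvt_ge (df := dW)) => //; first lra.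
    by move=> r tr rd; apply: Wd; lra.
  move=> r tr rd; apply: He; first lra.
  have := fK t r t0 (ltW tr).
  have : K * (r - t) <= e / 2.
    have -> : e / 2 = K * de by rewrite /de; field; rewrite gt_eqF.
    by rewrite ler_wpM2l ?ltW//; lra.
  have := lerB_dist (f t) (f r); rewrite distrC; lra.
have : W (t + de) <= sup S.
  by apply: ub_le_sup; [exact: hS.2|exists (t + de) => //=; lra].
have := Wnd T t T0 (ltW Tt).
rewrite (addrC t) addrK => *; lra.
Qed.

(** Integrating from -1 makes every [t >= 0] interior, so the derivative is two-sided even at 0. *)
Lemma continuous_primitive f : continuous f ->
  exists2 F : R -> R, F 0 = 0 &
    forall t : R, - 1 < t -> is_derive t (1 : R) F (f t).
Proof.
move=> fc.
pose G (x : R) : R := (\int[lebesgue_measure]_(t in [set` `[- 1, x]]) f t)%R.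
exists (fun x => G x - G 0) => [|t t1]; first by rewrite subrr.
have [||dG GE] := @continuous_FTC1_closed R f (- 1) t (t + 1) _ _ t1 (fc t).
- by rewrite ltrDl.
- apply: continuous_compact_integrable; first exact: segment_compact.
  exact: continuous_subspaceT.
rewrite -[f t]subr0; apply: is_deriveB.
by apply: DeriveDef => //; rewrite -GE derive1E.
Qed.

Lemma geometric_lt (C e : R) : 0 < e -> exists k, C * 2^-1 ^+ k < e.
Proof.
move=> e0; have : (fun k => C * 2^-1 ^+ k) @ \oo --> (0 : R).
  by apply: cvg_geometric; rewrite ger0_norm// invf_lt1// ltr1n.
move=> /cvgrPdist_lt/(_ e e0)[N _ HN]; exists N.
by have := HN N (leqnn _); rewrite /= sub0r normrN; apply: le_lt_trans; exact: ler_norm.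
Qed.

Lemma geometric_cauchy_lim (u : nat -> R) (C : R) :
  (forall k, `|u k.+1 - u k| <= C * 2^-1 ^+ k) ->
  forall k, `|lim (u @ \oo) - u k| <= 2 * C * 2^-1 ^+ k.
Proof.
move=> uC.
have C0 : 0 <= C by have := le_trans (normr_ge0 _) (uC 0%N); rewrite expr0 mulr1.
(* The factor [1 - 2^-j] comes from the partial geometric sum and closes the induction. *)
have d k j : `|u (k + j)%N - u k| <= 2 * C * 2^-1 ^+ k * (1 - 2^-1 ^+ j).
  elim: j => [|j IH]; first by rewrite addn0 !subrr normr0 mulr0.
  rewrite addnS -(subrK (u (k + j)%N) (u _.+1)) -addrA.
  apply: le_trans (ler_normD _ _) _.
  apply: le_trans (lerD (uC _) IH) _.
  rewrite exprD exprS; lra.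
have {}d k j : `|u (k + j)%N - u k| <= 2 * C * 2^-1 ^+ k.
  apply: le_trans (d k j) _; rewrite ler_piMr//.
  by rewrite !mulr_ge0// exprn_ge0.
have uc : cvg (u @ \oo).
  apply/cauchy_cvgP/cauchy_exP => e e0.
  have [N HN] := geometric_lt (2 * C) e0.
  exists (u N); exists N => // k /= Nk.
  rewrite -ball_normE /= -(subnKC Nk) distrC; exact: le_lt_trans (d _ _) HN.
move=> k.
have ul : (fun j => `|u j - u k|) @ \oo --> `|lim (u @ \oo) - u k|.
  by apply: cvg_norm; apply: cvgB => //; exact: cvg_cst.
rewrite -(cvg_lim _ ul)//; apply: limr_le; first by apply/cvg_ex; eexists; exact: ul.
by exists k => // j /= kj; rewrite -(subnKC kj).
Qed.

End Calculus.

(** * Coordinates and the sup norm of column vectors *)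

Section ColumnVectors.
Context {R : realType} {m : nat}.
Implicit Types v : 'cV[R]_m.

Lemma coord_le_norm v i : `|v i 0| <= `|v|.
Proof.
rewrite [leRHS]/Num.norm /= mx_normrE.
exact: (le_bigmax _ (fun k : 'I_m * 'I_1 => `|v k.1 k.2|) (i, 0)).
Qed.

Lemma cV_norm_le v (e : R) : 0 <= e -> (forall i, `|v i 0| <= e) -> `|v| <= e.
Proof.
move=> e0 ve; rewrite [leLHS]/Num.norm /= mx_normrE; apply: bigmax_le => //.
by move=> [i j] _ /=; rewrite (ord1 j).
Qed.

Lemma cvg_cV (T : Type) (F : set_system T) (FF : Filter F)
    (f : T -> 'cV[R]_m) v :
  (forall i, f x i 0 @[x --> F] --> v i 0) -> f x @[x --> F] --> v.
Proof.
move=> fv; apply/cvgrPdist_le => e e0.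
have : \forall x \near F, forall i, `|v i 0 - f x i 0| <= e.
  by apply: filter_forall => i; have /cvgrPdist_le/(_ e e0) := fv i.
by apply: filterS => x xe; apply: cV_norm_le => [|i]; [exact: ltW|rewrite !mxE; exact: xe].
Qed.

Lemma continuous_cV (T : topologicalType) (f : T -> 'cV[R]_m) :
  (forall i, continuous (fun x => f x i 0)) -> continuous f.
Proof. by move=> fc x; apply: cvg_cV => i; exact: fc. Qed.

Lemma continuous_coord (T : topologicalType) (f : T -> 'cV[R]_m) i :
  continuous f -> continuous (fun x => f x i 0).
Proof.
move=> fc x.
exact: (@continuous_comp _ _ _ f (fun v : 'cV[R]_m => v i 0) x (fc x) (@coord_continuous _ _ _ _ _ _)).
Qed.

End ColumnVectors.

(** * Global Picard iteration *)

Section Picard.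
Context {R : realType} {m : nat}.
Local Notation V := 'cV[R]_m.

Lemma continuous_primitive_cV (f : R -> V) : continuous f ->
  exists2 F : R -> V, F 0 = 0 & forall t : R, - 1 < t ->
    forall i, is_derive t (1 : R) (fun s => F s i 0) (f t i 0).
Proof.
move=> fc; have /choice[F FP] : forall i, exists F : R -> R, F 0 = 0 /\
    forall t : R, - 1 < t -> is_derive t (1 : R) F (f t i 0).
  by move=> i; have [F] := continuous_primitive (continuous_coord (i := i) fc); exists F.
exists (fun t => \col_i F i t) => [|t t1 i].
  by apply/colP => i; rewrite !mxE (FP i).1.
rewrite (_ : (fun s => _) = F i); first exact: (FP i).2.
by apply/funext => s; rewrite mxE.
Qed.

Lemma derivable_continuous_at (f : R -> R) (t df : R) :
  is_derive t (1 : R) f df -> {for t, continuous f}.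
Proof. by move=> fd; apply/differentiable_continuous/derivable1_diffP. Qed.

(** The iterates live on the whole half-line and converge uniformly on each [[0, T]], by a weighted
    norm built from the Lipschitz constant for that [T]; their limit is a global solution. *)
Theorem picard_lindelof (g : R -> V -> V) (z0 : V) :
  (forall z : R -> V, continuous z -> continuous (fun t => g t (z t))) ->
  (forall T : R, exists L : R, forall t x y, 0 <= t -> t <= T ->
     `|g t x - g t y| <= L * `|x - y|) ->
  exists z : R -> V, z 0 = z0 /\ forall t : R, 0 <= t ->
    forall i, is_derive t (1 : R) (fun s => z s i 0) (g t (z t) i 0).
Proof.
move=> gc gL.
(* [P z] is a primitive of [g t (z t)]; for discontinuous [z] it only has to vanish at 0, which
   makes the operator total. *)
have /choice[P PP] : forall z : R -> V, exists F : R -> V, F 0 = 0 /\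
    (continuous z -> forall t : R, - 1 < t ->
      forall i, is_derive t (1 : R) (fun s => F s i 0) (g t (z t) i 0)).
  move=> z; have [zc|nzc] := pselect (continuous z); last by exists (fun=> 0).
  by have [F] := continuous_primitive_cV (gc z zc); exists F.
(* The Picard operator, frozen at its initial value for negative times so that iterates are
   continuous on all of [R]. *)
have [J JE] : exists J, forall z t, J z t = z0 + P z (Num.max t 0).
  by exists (fun z t => z0 + P z (Num.max t 0)).
have J0 z : J z 0 = z0 by rewrite JE maxxx (PP z).1 addr0.
have Jc z : continuous z -> continuous (J z).
  move=> zc; apply: continuous_cV => i t.
  rewrite (_ : (fun x => _) = (fun x => z0 i 0 + P z (Num.max x 0) i 0)).
    apply: cvgD; first exact: cvg_cst.
    apply: (@continuous_comp _ _ _ (fun x : R => Num.max x 0) (fun s => P z s i 0)).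
      exact: (continuous_max (@cvg_id _ _) (@cvg_cst _ _ _ _ _)).
    apply: (derivable_continuous_at ((PP z).2 zc _ _ i)).
    by rewrite lt_max; apply/orP; right; lra.
  by apply/funext => x; rewrite JE mxE.
have Jd z : continuous z -> forall t : R, 0 < t ->
    forall i, is_derive t (1 : R) (fun s => J z s i 0) (g t (z t) i 0).
  move=> zc t t0 i.
  have nt : \forall s \near t, z0 i 0 + P z s i 0 = J z s i 0.
    have : \forall s \near t, 0 < s by exact: (cvgr_gt t (@cvg_id _ _)).
    by apply: filterS => s s0; rewrite JE mxE max_l ?ltW.
  apply: (near_eq_is_derive nt); rewrite -[g _ _ _ _]add0r.
  apply: (is_deriveD (f := cst (z0 i 0))).
  by apply: (PP z).2 => //; lra.
(* The weight [exp (2 L t)] makes one Picard step contract by 1/2. *)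
have contr (T L a : R) z z' : 0 < L -> 0 <= a ->
    (forall t x y, 0 <= t -> t <= T -> `|g t x - g t y| <= L * `|x - y|) ->
    continuous z -> continuous z' ->
    (forall t : R, 0 <= t -> t <= T -> `|z t - z' t| <= a * expR (2 * L * t)) ->
    forall t : R, 0 <= t -> t <= T ->
      `|J z t - J z' t| <= a * 2^-1 * expR (2 * L * t).
  move=> L0 a0 gL' zc zc' zz t t0 tT; apply: cV_norm_le => [|i].
    by rewrite !mulr_ge0// expR_ge0.
  have [zero|t_gt0] := eqVneq t 0.
    by rewrite zero !J0 subrr mxE normr0 !mulr_ge0// expR_ge0.
  suff H y y' : continuous y -> continuous y' ->
      (forall t : R, 0 <= t -> t <= T -> `|y t - y' t| <= a * expR (2 * L * t)) ->
      J y t i 0 - J y' t i 0 <= a * 2^-1 * expR (2 * L * t).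
    rewrite !mxE ler_norml; apply/andP; split; last exact: H.
    rewrite lerNl opprB; apply: H => // s s0 sT; rewrite distrC; exact: zz.
  move=> yc y'c yy.
  (* The bound grows at rate [L a exp(2 L s)], which dominates the difference of the two fields; so
     [f] does not rise above its initial value [- a / 2]. *)
  pose f := (fun s => J y s i 0 - J y' s i 0 - a * 2^-1 * expR (2 * L * s)).
  have e2 (s : R) : is_derive s (1 : R) (fun s => a * 2^-1 * expR (2 * L * s))
      (a * L * expR (2 * L * s)).
    have d2 : is_derive s (1 : R) (fun s => 2 * L * s) (2 * L).
      by apply: is_derive_eq; rewrite /GRing.scale /=; ring.
    have := is_deriveZ (a * 2^-1) (is_derive1_comp (is_derive_expR (2 * L * s)) d2).
    rewrite (_ : a * L * _ = a * 2^-1 *: (expR (2 * L * s) * (2 * L)))//.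
    by rewrite /GRing.scale /=; field.
  have fd (s : R) : 0 < s -> is_derive s (1 : R) f
      (g s (y s) i 0 - g s (y' s) i 0 - a * L * expR (2 * L * s)).
    by move=> s0; apply: is_deriveB; apply: is_deriveB; exact: Jd.
  have fc : continuous f.
    move=> s; apply: cvgB; last exact: (derivable_continuous_at (e2 s)).
    by apply: cvgB; exact: (continuous_coord (i := i) (Jc _ _)).
  have := mvt_le t0 fc (fun s s0 _ => fd s s0) (k := 0).
  rewrite /f !J0 subrr mul0r mulr0 expR0 => /(_ _); rewrite mulr1 => h.
  suff : J y t i 0 - J y' t i 0 - a / 2 * expR (2 * L * t) - (0 - a / 2) <= 0 by lra.
  apply: h => s s0 st.
  have sT : s <= T by lra.
  have : g s (y s) i 0 - g s (y' s) i 0 <= L * (a * expR (2 * L * s)).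
    apply: le_trans (ler_norm _) _.
    have := coord_le_norm (g s (y s) - g s (y' s)) i; rewrite !mxE.
    move=> /le_trans; apply; apply: le_trans (gL' _ _ _ (ltW s0) sT) _.
    by rewrite (ler_wpM2l (ltW L0))// yy// ltW.
  lra.
pose z k := iter k J (fun=> z0).
have zc k : continuous (z k).
  elim: k => [|k IH]; first exact: cst_continuous.
  exact: Jc.
have zmax k t : z k t = z k (Num.max t 0).
  by case: k => [//|k] /=; rewrite !JE -maxA maxxx.
have step (T : R) : 0 <= T -> exists LD : R * R, [/\ 0 < LD.1, 0 <= LD.2,
    (forall t x y, 0 <= t -> t <= T -> `|g t x - g t y| <= LD.1 * `|x - y|) &
    forall k t, t <= T -> `|z k.+1 t - z k t| <= LD.2 * 2^-1 ^+ k].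
  move=> T0.
  have [L [L0 gL']] : exists L, 0 < L /\
      forall t x y, 0 <= t -> t <= T -> `|g t x - g t y| <= L * `|x - y|.
    have [L HL] := gL T; exists (`|L| + 1); split; first by rewrite ltr_wpDl.
    move=> t x y t0 tT; apply: le_trans (HL _ _ _ t0 tT) _; rewrite ler_wpM2r//.
    by rewrite ler_wpDr// ler_norm.
  have [|c _ cM] := @EVT_max R (fun t => `|z 1%N t - z 0%N t|) 0 T T0.
    apply: continuous_subspaceT => t; apply: cvg_norm.
    by apply: cvgB; exact: zc.
  set M := `|_| in cM.
  have M0 : 0 <= M by exact: normr_ge0.
  have h k t : 0 <= t -> t <= T ->
      `|z k.+1 t - z k t| <= M * 2^-1 ^+ k * expR (2 * L * t).
    elim: k t => [|k IH] t t0 tT.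
      rewrite expr0 mulr1; apply: le_trans (cM t _) _; first by rewrite in_itv /= t0.
      by rewrite ler_peMr// -expR0 ler_expR !mulr_ge0// ltW.
    rewrite exprSr mulrA; apply: (contr T L _ (z k.+1) (z k)) => //.
    by rewrite mulr_ge0// exprn_ge0.
  exists (L, M * expR (2 * L * T)); split=> //; first by rewrite mulr_ge0// expR_ge0.
  move=> k t tT; rewrite (zmax k.+1 t) (zmax k t).
  have mT : Num.max t 0 <= T by rewrite ge_max tT.
  apply: le_trans (h _ _ _ mT) _; first by rewrite le_max lexx orbT.
  rewrite /= mulrAC ler_wpM2r ?exprn_ge0// ler_wpM2l// ler_expR ler_wpM2l//.
  by rewrite mulr_ge0// ltW.
pose zl t : V := \col_i lim (z k t i 0 @[k --> \oo]).
have zlP (T : R) : 0 <= T -> exists LD : R * R, [/\ 0 < LD.1, 0 <= LD.2,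
    (forall t x y, 0 <= t -> t <= T -> `|g t x - g t y| <= LD.1 * `|x - y|) &
    forall k t, t <= T -> `|zl t - z k t| <= LD.2 * 2^-1 ^+ k].
  move=> /step[[L D] /= [L0 D0 gL' Hk]]; exists (L, 2 * D); split=> //=.
    by rewrite mulr_ge0.
  move=> k t tT; apply: cV_norm_le => [|i]; first by rewrite !mulr_ge0// exprn_ge0.
  rewrite 2!mxE [(- z k t) i 0]mxE.
  apply: (geometric_cauchy_lim (u := fun k => z k t i 0)) => j.
  apply: le_trans (Hk j t tT).
  by have := coord_le_norm (z j.+1 t - z j t) i; rewrite [_ i 0]mxE [(- z j t) i 0]mxE.
have zlc : continuous zl.
  move=> t; apply/cvgrPdist_le => e e0.
  have T0 : 0 <= Num.max t 0 + 1 by rewrite addr_ge0// le_max lexx orbT.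
  have [[_ D] /= [_ D0 _ HD]] := zlP _ T0.
  have [k Hk] := geometric_lt D (divr_gt0 e0 (ltr0n R 3)).
  have /cvgrPdist_lt/(_ _ (divr_gt0 e0 (ltr0n R 3))) : z k x @[x --> t] --> z k t by exact: zc.
  have tT : t < Num.max t 0 + 1 by rewrite ltr_pwDr// le_max lexx.
  have : \forall s \near t, s < Num.max t 0 + 1 by exact: (cvgr_lt t (@cvg_id _ _)).
  apply: filterS2 => s sT zs.
  have -> : zl t - zl s = (zl t - z k t) + (z k t - z k s) - (zl s - z k s).
    by rewrite addrA subrK opprB addrA subrK.
  apply: le_trans (ler_normB _ _) _; apply: le_trans (lerD (ler_normD _ _) (lexx _)) _.
  have := HD k t (ltW tT); have := HD k s (ltW sT); lra.
have Jzl t : 0 <= t -> J zl t = zl t.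
  move=> t0; apply/eqP; rewrite -subr_eq0 -normr_le0 leNgt; apply/negP => e0.
  have [[L D] /= [L0 D0 gL' HD]] := zlP _ t0.
  have [k Hk] := geometric_lt (D * expR (2 * L * t) + D) e0.
  have e1 s : 0 <= s -> 1 <= expR (2 * L * s).
    by move=> s0; rewrite -expR0 ler_expR !mulr_ge0// ltW.
  have Dk : 0 <= D * 2^-1 ^+ k by rewrite mulr_ge0// exprn_ge0.
  have : `|J zl t - z k.+1 t| <= D * 2^-1 ^+ k * 2^-1 * expR (2 * L * t).
    apply: (contr t L _ zl (z k)) => // s s0 st.
    by apply: le_trans (HD k s st) _; rewrite ler_peMr// e1.
  have := HD k.+1 t (lexx _); rewrite exprS.
  have := ler_normB (J zl t - z k.+1 t) (zl t - z k.+1 t).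
  rewrite (_ : J zl t - z k.+1 t - _ = J zl t - zl t); last first.
    by rewrite opprB addrA subrK.
  have := mulr_ge0 Dk (ltW (expR_gt0 (2 * L * t))).
  lra.
(* Dropping the truncation of [J] gives a two-sided derivative at 0 as well; the values for [t >= 0]
   are those of [zl]. *)
exists (fun t => z0 + P zl t); split; first by rewrite (PP zl).1 addr0.
move=> t t0 i.
have -> : z0 + P zl t = zl t by rewrite -(Jzl t t0) JE max_l.
rewrite -[g _ _ _ _]add0r.
rewrite (_ : (fun s => _) = cst (z0 i 0) + (fun s => P zl s i 0)); last first.
  by apply/funext => s; rewrite mxE.
apply: is_deriveD.
by apply: (PP zl).2 => //; lra.
Qed.

End Picard.

(** * The vector field in logarithmic coordinates, and its clipping *)

Section LogCoordinates.
Context {R : realType} {n m : nat} (A : 'M[R]_(n, m)) (c d y : 'cV[R]_m).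
Hypotheses (c0 : pos_vec c) (d0 : pos_vec d).
Local Notation V := 'cV[R]_m.

Definition expv (z : V) : V := \col_i expR (z i 0).

Lemma expv_gt0 z : pos_vec (expv z).
Proof. by move=> i; rewrite mxE expR_gt0. Qed.

Let q z := min_energy_sol A (A *m y) c (expv z).
Let u z := tension c (expv z) (q z).

Definition log_field (z : V) : V := \col_i (d i 0 * (u z i 0 / c i 0 - 1)).

Lemma expR_lipschitz (r a b : R) : a <= r -> b <= r ->
  `|expR a - expR b| <= expR r * `|a - b|.
Proof.
wlog ba : a b / b <= a => [H ar br|ar _].
  case: (leP b a) => [ba|/ltW ab]; first exact: H.
  by rewrite distrC (distrC a); exact: H.
rewrite !ger0_norm ?subr_ge0 ?ler_expR//.
apply: (@le_trans _ _ (expR a * (a - b))); last first.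
  by rewrite ler_wpM2r ?subr_ge0// ler_expR.
have : 1 + (b - a) <= expR (b - a) by exact: expR_ge1Dx.
have -> : expR b = expR a * expR (b - a) by rewrite -expRD addrC subrK.
have := expR_gt0 a; nra.
Qed.

(* With [w = x / c], the difference [v] of two tensions is orthogonal to the
   difference of the two flows, i.e. [sum w v^2 = sum v (w' - w) u']. *)
Lemma tension_sub_form z z' :
  let w (z : V) i := expR (z i 0) / c i 0 in
  \sum_i w z i * (u z i 0 - u z' i 0) ^+ 2 =
  \sum_i (u z i 0 - u z' i 0) * (w z' i - w z i) * u z' i 0.
Proof.
move=> w.
have [Aq [p up]] := min_energy_solP A c0 y (expv_gt0 z).
have [Aq' [p' up']] := min_energy_solP A c0 y (expv_gt0 z').
have qE z1 i : q z1 i 0 = w z1 i * u z1 i 0.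
  rewrite !mxE /w; field; rewrite gt_eqF ?expR_gt0//=.
  by rewrite gt_eqF.
have : dotv (u z - u z') (q z - q z') = 0.
  rewrite /u /q up up' -mulmxBr dotv_trmul mulmxBr Aq Aq' subrr.
  by rewrite /dotv big1// => i _; rewrite [X in _ * X]mxE mulr0.
rewrite /dotv => E; apply/eqP; rewrite -subr_eq0 -sumrB; apply/eqP.
rewrite -[RHS]E; apply: eq_bigr => i _.
have sE (f g : V) : (f - g) i 0 = f i 0 - g i 0 by rewrite !mxE.
by rewrite !sE !qE; ring.
Qed.

(** With [a = |u - u'|] and [de = |z - z'|], the preceding identity bounds each [(u_j - u'_j)^2] by
    [a L de], the weights being at least [exp(-r) / c_j]. Hence [a^2 <= a L de], and [a] cancels. *)
Lemma tension_lipschitz (r : R) : exists2 L : R, 0 <= L & forall z z' : V,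
  (forall i, `|z i 0| <= r) -> (forall i, `|z' i 0| <= r) ->
  `|u z - u z'| <= L * `|z - z'|.
Proof.
have [Q Q0 qQ] := min_energy_sol_bounded A y c0.
pose S : R := \sum_i c i 0.
have S0 : 0 <= S by apply: sumr_ge0 => i _; rewrite ltW.
(* [S] bounds each [c_j]; one [exp r] comes from the size of the tension, one from the Lipschitz
   constant of [exp], one from the inverse weight; [m] counts the summands. *)
pose L := S * expR r ^+ 3 * Q * m%:R.
have L0 : 0 <= L by rewrite !mulr_ge0// ?exprn_ge0 ?expR_ge0// ltW.
exists L => // z z' zr z'r; set a : R := `|u z - u z'|; set de : R := `|z - z'|.
have a0 : 0 <= a by exact: normr_ge0.
have de0 : 0 <= de by exact: normr_ge0.
have vE i : (u z - u z') i 0 = u z i 0 - u z' i 0 by rewrite !mxE.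
have zE i : (z - z') i 0 = z i 0 - z' i 0 by rewrite !mxE.
have va i : `|u z i 0 - u z' i 0| <= a by rewrite -vE; exact: coord_le_norm.
have rle (x : R) : `|x| <= r -> x <= r /\ - r <= x.
  by rewrite ler_norml => /andP[].
have term i : (u z i 0 - u z' i 0) * (expR (z' i 0) / c i 0 - expR (z i 0) / c i 0)
    * u z' i 0 <= a * (expR r ^+ 2 * Q * de).
  have uQ : `|u z' i 0| <= c i 0 * expR r * Q.
    rewrite mxE normrM ler_pM//; last exact: qQ (expv_gt0 _) _.
    rewrite gtr0_norm ?divr_gt0 ?expv_gt0// (ler_wpM2l (ltW (c0 i)))// mxE -expRN ler_expR.
    by have := (rle _ (z'r i)).2; lra.
  have wl : `|expR (z' i 0) / c i 0 - expR (z i 0) / c i 0| <= expR r * de / c i 0.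
    have ci : 0 <= (c i 0)^-1 by rewrite invr_ge0 ltW.
    rewrite -mulrBl normrM (ger0_norm ci) (ler_wpM2r ci)//.
    apply: le_trans (expR_lipschitz (rle _ (z'r i)).1 (rle _ (zr i)).1) _.
    by rewrite ler_wpM2l ?expR_ge0// distrC -zE; exact: coord_le_norm.
  apply: le_trans (ler_norm _) _; rewrite !normrM.
  have -> : a * (expR r ^+ 2 * Q * de) = a * (expR r * de / c i 0) * (c i 0 * expR r * Q).
    by field; rewrite gt_eqF.
  by apply: ler_pM => //; apply: ler_pM.
have vj j : (u z j 0 - u z' j 0) ^+ 2 <= a * (L * de).
  have cj : c j 0 <= S.
    by rewrite /S (bigD1 j) //= lerDl sumr_ge0// => i _; rewrite ltW.
  have : expR (z j 0) / c j 0 * (u z j 0 - u z' j 0) ^+ 2 <=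
      m%:R * (a * (expR r ^+ 2 * Q * de)).
    have -> : m%:R * (a * (expR r ^+ 2 * Q * de)) =
        \sum_(i < m) a * (expR r ^+ 2 * Q * de).
      by rewrite sumr_const card_ord mulr_natl.
    apply: (@le_trans _ _ (\sum_i expR (z i 0) / c i 0 * (u z i 0 - u z' i 0) ^+ 2)).
      rewrite (bigD1 j) //= lerDl sumr_ge0// => i _.
      by rewrite mulr_ge0 ?sqr_ge0// divr_ge0 ?expR_ge0// ltW.
    by rewrite tension_sub_form; apply: ler_sum => i _; exact: term.
  rewrite mulrAC ler_pdivrMr// => h0.
  have X0 : 0 <= m%:R * (a * (expR r ^+ 2 * Q * de)).
    by rewrite !mulr_ge0// ?exprn_ge0 ?expR_ge0// ltW.
  have h := le_trans h0 (ler_wpM2l X0 cj).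
  have : expR r * (expR (z j 0) * (u z j 0 - u z' j 0) ^+ 2) <= a * (L * de).
    apply: le_trans (ler_wpM2l (expR_ge0 _) h) _.
    have -> : a * (L * de) = expR r * (m%:R * (a * (expR r ^+ 2 * Q * de)) * S).
      by rewrite /L; ring.
    by [].
  apply: le_trans; rewrite mulrA ler_peMl ?sqr_ge0// -expRD -expR0 ler_expR.
  by have [_ ] := rle _ (zr j); lra.
have aS : a <= Num.sqrt (a * (L * de)).
  apply: cV_norm_le => [|i]; first exact: sqrtr_ge0.
  by rewrite vE -sqrtr_sqr ler_wsqrtr.
suff key : a <= L * de by exact: key.
have Lde0 : 0 <= L * de by exact: mulr_ge0.
have : a ^+ 2 <= a * (L * de).
  rewrite -[leRHS](sqr_sqrtr (mulr_ge0 a0 Lde0)).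
  by rewrite ler_sqr// nnegrE ?sqrtr_ge0.
have [a00 _|an0] := eqVneq a 0; first by rewrite [leLHS]a00.
by rewrite expr2 ler_pM2l// lt_neqAle eq_sym an0.
Qed.

Lemma log_field_lipschitz (r : R) : exists2 L : R, 0 <= L & forall z z' : V,
  (forall i, `|z i 0| <= r) -> (forall i, `|z' i 0| <= r) ->
  `|log_field z - log_field z'| <= L * `|z - z'|.
Proof.
have [L L0 LP] := tension_lipschitz r.
pose S : R := \sum_i d i 0 / c i 0.
have S0 i : 0 <= d i 0 / c i 0 by rewrite divr_ge0 ?ltW.
exists (S * L) => [|z z' zr z'r]; first by rewrite mulr_ge0// sumr_ge0.
apply: cV_norm_le => [|i]; first by rewrite !mulr_ge0// sumr_ge0.
have -> : (log_field z - log_field z') i 0 = d i 0 / c i 0 * (u z - u z') i 0.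
  have sE (f g : V) : (f - g) i 0 = f i 0 - g i 0 by rewrite !mxE.
  have lE z1 : log_field z1 i 0 = d i 0 * (u z1 i 0 / c i 0 - 1) by rewrite mxE.
  by rewrite !sE !lE; field; rewrite gt_eqF.
rewrite normrM -mulrA (ger0_norm (S0 i)); apply: ler_pM => //.
  by rewrite /S (bigD1 i) //= lerDl sumr_ge0.
exact: le_trans (coord_le_norm _ _) (LP _ _ zr z'r).
Qed.

Lemma log_field_continuous : continuous log_field.
Proof.
move=> z; apply/(@cvgrPdist_le _ _ _ (nbhs z)) => e e0.
have [L L0 LP] := log_field_lipschitz (`|z| + 1).
have eL : 0 < e / (L + 1) by rewrite divr_gt0// ltr_wpDl.
have : \forall z' \near z, `|z - z'| < e / (L + 1).
  exact: (@cvgr_dist_lt _ _ _ (nbhs z) _ id z (@cvg_id _ _) _ eL).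
have : \forall z' \near z, `|z - z'| < 1.
  exact: (@cvgr_dist_lt _ _ _ (nbhs z) _ id z (@cvg_id _ _) _ ltr01).
apply: filterS2 => z' z1 ze; apply: le_trans (LP _ _ _ _) _ => [i|i|].
- by rewrite (le_trans (coord_le_norm _ _))// lerDl.
- apply: le_trans (coord_le_norm _ _) _.
  have := ler_normB z (z - z'); rewrite opprB addrC subrK; lra.
apply: (@le_trans _ _ (L * (e / (L + 1)))); first by rewrite ler_wpM2l// ltW.
have h : L / (L + 1) <= 1 by rewrite ler_pdivrMr ?mul1r ?lerDl// ltr_wpDl.
by rewrite mulrCA (ler_piMr (ltW e0) h).
Qed.

Definition clip (r : R) (z : V) : V := \col_i Num.max (- r) (Num.min (z i 0) r).

Lemma clip_norm r (z : V) i : 0 <= r -> `|clip r z i 0| <= r.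
Proof.
by move=> r0; rewrite mxE ler_norml le_max lexx ge_max ge_min lexx orbT andbT; lra.
Qed.

Lemma clip_id r (z : V) : (forall i, `|z i 0| <= r) -> clip r z = z.
Proof.
move=> zr; apply/colP => i; rewrite mxE; have := zr i.
by rewrite ler_norml => /andP[h1 h2]; rewrite min_l// max_r.
Qed.

Lemma clip_ge r (z : V) i (b : R) : b <= r -> b <= z i 0 -> b <= clip r z i 0.
Proof. by move=> br bz; rewrite mxE le_max le_min br bz orbT. Qed.

Lemma clip_lipschitz r (z z' : V) : `|clip r z - clip r z'| <= `|z - z'|.
Proof.
apply: cV_norm_le => // i; apply: le_trans (coord_le_norm _ i).
rewrite !mxE; move: (z i 0) (z' i 0) => a b.
have := ler_norm (a - b); have := ler_norm (b - a); rewrite distrC.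
rewrite ler_norml; move: `|a - b| => N h1 h2; rewrite !maxEge !minEle.
case: (lerP a r) => ?; case: (lerP b r) => ?.
all: repeat (case: (lerP _ (- r)) => ?).
all: apply/andP; split; lra.
Qed.

Lemma clip_continuous (r : R -> R) (z : R -> V) : continuous r -> continuous z ->
  continuous (fun t => clip (r t) (z t)).
Proof.
move=> rc zc; apply: continuous_cV => i t.
rewrite (_ : (fun t => _) = (fun t => Num.max (- r t) (Num.min (z t i 0) (r t)))).
  apply: (@continuous_max _ _ (fun t => - r t) (fun t => Num.min (z t i 0) (r t))).
    exact: (continuousN (rc t)).
  apply: (@continuous_min _ _ (fun t => z t i 0) r); last exact: rc.
  exact: (continuous_coord (i := i) zc).
by apply/funext => s; rewrite mxE.
Qed.


(** Up to time [T] clipped states stay in the box of radius [r T], where [log_field] is Lipschitz,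
    and clipping is nonexpansive; so the global Picard theorem applies. *)
Lemma clipped_solution (r : R -> R) (z0 : V) : continuous r ->
  (forall t, 0 <= r t) ->
  (forall s t, 0 <= s -> s <= t -> r s <= r t) ->
  exists z : R -> V, z 0 = z0 /\ forall t : R, 0 <= t ->
    forall i, is_derive t (1 : R) (fun s => z s i 0)
      (log_field (clip (r t) (z t)) i 0).
Proof.
move=> rc r0 rnd; apply: (picard_lindelof (g := fun t x => log_field (clip (r t) x))) => [z zc|T].
  move=> t; exact: (@continuous_comp _ _ _ (fun t => clip (r t) (z t)) log_field t
    (@clip_continuous r z rc zc t) (@log_field_continuous _)).
have [L L0 LP] := log_field_lipschitz (r T).
exists L => t x x' t0 tT.
have le_rT z i : `|clip (r t) z i 0| <= r T.
  by apply: le_trans (clip_norm z i (r0 t)) _; exact: rnd.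
apply: le_trans (LP _ _ (le_rT x) (le_rT x')) _.
by rewrite ler_wpM2l// clip_lipschitz.
Qed.

End LogCoordinates.

(** * Functions frozen before time 0, and coordinatewise calculus *)

Section NonnegativeTimes.
Context {R : realType}.

Lemma continuous_max0 (f : R -> R) : (forall t : R, 0 <= t -> {for t, continuous f}) ->
  continuous (fun t : R => f (Num.max t 0)).
Proof.
move=> fc t; apply: (@continuous_comp _ _ _ (fun x : R => Num.max x 0) f t).
  exact: (continuous_max (@cvg_id _ _) (@cvg_cst _ _ _ _ _)).
by apply: fc; rewrite le_max lexx orbT.
Qed.

Lemma is_derive_max0 (f : R -> R) (t df : R) : 0 < t ->
  is_derive t (1 : R) f df -> is_derive t (1 : R) (fun s => f (Num.max s 0)) df.
Proof.
move=> t0; apply: near_eq_is_derive.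
have : \forall s \near t, (0 : R) < s by exact: (cvgr_gt t (@cvg_id _ _)).
by apply: filterS => s s0; rewrite max_l ?ltW.
Qed.

Lemma is_derive_sumZ (m : nat) (a : 'I_m -> R) (f : 'I_m -> R -> R) (df : 'I_m -> R)
    (t : R) : (forall i, is_derive t (1 : R) (f i) (df i)) ->
  is_derive t (1 : R) (fun s => \sum_i a i * f i s) (\sum_i a i * df i).
Proof.
move=> fd; rewrite (_ : (fun s => _) = \sum_i (a i \*: f i)).
  by apply: is_derive_sum => i; exact: is_deriveZ.
by apply/funext => s; rewrite fct_sumE.
Qed.

Lemma cvg_sum_ord (T : Type) (F : set_system T) (FF : Filter F) (m : nat)
    (f : 'I_m -> T -> R) (l : 'I_m -> R) :
  (forall i, f i x @[x --> F] --> l i) ->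
  \sum_i f i x @[x --> F] --> \sum_i l i.
Proof.
elim: m f l => [|m IH] f l fl.
  rewrite big_ord0 (_ : (fun x => _) = cst 0); first exact: cvg_cst.
  by apply/funext => x; rewrite big_ord0.
rewrite big_ord_recl.
rewrite (_ : (fun x => _) = (fun x => f ord0 x + \sum_i f (lift ord0 i) x)).
  by apply: cvgD => //; apply: IH.
by apply/funext => x; rewrite big_ord_recl.
Qed.

Lemma continuous_sumZ (m : nat) (a : 'I_m -> R) (f : 'I_m -> R -> R) :
  (forall i, continuous (f i)) -> continuous (fun s => \sum_i a i * f i s).
Proof.
move=> fc t; apply: cvg_sum_ord => i.
by apply: cvgM; [exact: cvg_cst|exact: fc].
Qed.

Lemma has_derivative_nneg_coord (m : nat) (x : R -> 'cV[R]_m) (t : R) (v : 'cV[R]_m) :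
  (forall i, is_derive t (1 : R) (fun s => x s i 0) (v i 0)) ->
  has_derivative_nneg x t v.
Proof.
move=> xd; apply: cvg_cV => i.
have [dx dxE] := xd i.
have dcvg : h^-1 *: (x (h *: (1 : R) + t) i 0 - x t i 0) @[h --> 0^'] --> v i 0.
  by move: dx; rewrite -dxE; exact.
have Q : h^-1 * (x (t + h) i 0 - x t i 0)
    @[h --> within [set h | 0 <= t + h] 0^'] --> v i 0.
  apply: cvg_trans dcvg; apply: cvg_trans (cvg_app _ (cvg_within _)).
  by apply: near_eq_cvg; near=> h; rewrite /GRing.scale /= mulr1 [t + h]addrC.
by apply: cvg_trans Q; apply: near_eq_cvg; near=> h; rewrite !mxE.
Unshelve. all: by end_near.
Qed.

End NonnegativeTimes.

(** * A priori bounds for the clipped equation *)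

Section Existence.
Context {R : realType} {n m : nat} (A : 'M[R]_(n, m)) (c d y x0 : 'cV[R]_m).
Hypotheses (c0 : pos_vec c) (d0 : pos_vec d) (y0 : forall i, 0 <= y i 0).
Local Notation V := 'cV[R]_m.

(* The two exponents come from the functional [sum (c/d) y z], whose derivative
   [E - c^T y] is bounded below whatever the clipping level is. *)
Lemma log_field_a_priori (z0 : V) : exists B al be N : R,
  [/\ 0 <= B, 0 <= al, 0 <= be, 0 <= N &
  forall (Z : R -> V) (r : R -> R),
    (forall i, continuous (fun t => Z t i 0)) -> Z 0 = z0 ->
    (forall t, 0 <= t -> B <= r t) ->
    (forall t : R, 0 < t -> forall i, is_derive t (1 : R) (fun s => Z s i 0)
       (log_field A c d y (clip (r t) (Z t)) i 0)) ->
    forall t i, 0 <= t -> `|Z t i 0| <= B + N * t * expR (al + be * t)].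
Proof.
have [Q Q0 qQ] := min_energy_sol_bounded A y c0.
have [K K0 uK] := tension_le_energy A y c0.
pose B := `|z0| + Q; pose opt := dotv c y.
(* [ka] bounds the inverse weights of the functional; only the support of [y] contributes, since
   division by zero gives 0. *)
pose ka : R := \sum_i d i 0 / (c i 0 * y i 0).
pose S : R := \sum_i c i 0 / d i 0 * y i 0.
pose M : R := \sum_i c i 0 * y i 0 ^+ 2.
pose N : R := \sum_i d i 0 * (K * M / c i 0 + 1).
have B0 : 0 <= B by rewrite addr_ge0// ltW.
have opt0 : 0 <= opt by apply: sumr_ge0 => i _; rewrite mulr_ge0// ltW.
have kai i : 0 <= d i 0 / (c i 0 * y i 0) by rewrite divr_ge0 ?mulr_ge0// ltW.
have ka0 : 0 <= ka by apply: sumr_ge0 => i _.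
have Si i : 0 <= c i 0 / d i 0 * y i 0 by rewrite mulr_ge0// divr_ge0// ltW.
have S0 : 0 <= S by apply: sumr_ge0 => i _.
have Mi i : 0 <= c i 0 * y i 0 ^+ 2 by rewrite mulr_ge0 ?sqr_ge0// ltW.
have M0 : 0 <= M by apply: sumr_ge0 => i _.
have Ni i : 0 <= d i 0 * (K * M / c i 0 + 1).
  apply: mulr_ge0; first exact: ltW.
  by rewrite addr_ge0// divr_ge0 ?mulr_ge0// ltW.
have N0 : 0 <= N by apply: sumr_ge0 => i _.
have z0B i : `|z0 i 0| <= B by rewrite (le_trans (coord_le_norm _ _))// lerDl ltW.
exists B, (ka * (2 * S * B)), (ka * opt), N; split=> //; try by rewrite !mulr_ge0.
move=> Z r Zc Z0 rB Zd.
pose w t := clip (r t) (Z t).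
pose q t := min_energy_sol A (A *m y) c (expv (w t)).
pose u t := tension c (expv (w t)) (q t).
have wpos t : pos_vec (expv (w t)) by exact: expv_gt0.
have ZdE (t : R) : 0 < t -> forall i, is_derive t (1 : R) (fun s => Z s i 0)
    (d i 0 * (u t i 0 / c i 0 - 1)).
  by move=> t0 i; have := Zd t t0 i; rewrite mxE.
(* Above [B] a coordinate does not increase: there the clipped one is at least [B], and
   [exp B >= 1 + B >= Q] dominates the flow. *)
have ZB t i : 0 <= t -> Z t i 0 <= B.
  apply: (barrier_le (Zc i) (fun t t0 => ZdE t t0 i)) => [|{}t t0 Bt].
    by rewrite Z0 (le_trans (ler_norm _)).
  rewrite pmulr_rle0// subr_le0 ler_pdivrMr// mul1r mxE.
  have -> : c i 0 / expv (w t) i 0 * q t i 0 = c i 0 * (q t i 0 / expv (w t) i 0).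
    by rewrite mulrA mulrAC.
  rewrite (ler_piMr (ltW (c0 i)))// (ler_pdivrMr _ _ (wpos t i)) mul1r.
  apply: le_trans (ler_norm _) (le_trans (qQ _ (wpos t) i) _).
  rewrite mxE (@le_trans _ _ (1 + B))//.
    by rewrite /B; have := normr_ge0 z0; lra.
  apply: le_trans (expR_ge1Dx _) _; rewrite ler_expR.
  by apply: clip_ge; [apply: rB; exact: ltW|exact: ltW].
(* All other coordinates are at most [B], so the linear lower bound on the functional passes to
   coordinate [j]. *)
have Zlow t j : 0 <= t -> 0 < y j 0 ->
    - (ka * (2 * S * B) + ka * opt * t) <= Z t j 0.
  move=> t0 yj.
  have VdE (s : R) : 0 < s -> is_derive s (1 : R)
      (fun s => \sum_i c i 0 / d i 0 * y i 0 * Z s i 0) (energy c (expv (w s)) (q s) - opt).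
    move=> s0; rewrite (energy_min_energy_sol c0 (wpos s) (erefl (A *m y))).
    rewrite (_ : _ - opt = \sum_i c i 0 / d i 0 * y i 0 * (d i 0 * (u s i 0 / c i 0 - 1))).
      by apply: is_derive_sumZ => i; exact: ZdE.
    rewrite /opt /dotv -sumrB; apply: eq_bigr => i _; rewrite -/(q s) -/(u s).
    by field; rewrite !gt_eqF.
  have Vc : continuous (fun s => \sum_i c i 0 / d i 0 * y i 0 * Z s i 0).
    exact: continuous_sumZ.
  have := mvt_ge t0 Vc (fun s s0 _ => VdE s s0) (k := - opt).
  rewrite subr0 Z0 => /(_ _)-VL.
  have {}VL : - opt * t <= \sum_i c i 0 / d i 0 * y i 0 * Z t i 0 -
                        \sum_i c i 0 / d i 0 * y i 0 * z0 i 0.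
    by apply: VL => s _ _; rewrite lerDr energy_ge0.
  have V0 : - (S * B) <= \sum_i c i 0 / d i 0 * y i 0 * z0 i 0.
    rewrite /S mulr_suml -sumrN; apply: ler_sum => i _.
    by rewrite -mulrN ler_wpM2l//; have := z0B i; rewrite ler_norml => /andP[].
  have Vt : \sum_i c i 0 / d i 0 * y i 0 * Z t i 0 <=
      c j 0 / d j 0 * y j 0 * Z t j 0 + S * B.
    rewrite (bigD1 j) //= lerD2l /S mulr_suml [leRHS](bigD1 j) //=.
    rewrite (ler_wpDl (mulr_ge0 (Si j) B0))//; apply: ler_sum => i _.
    by rewrite ler_wpM2l// ZB.
  have kj : d j 0 / (c j 0 * y j 0) <= ka.
    by rewrite /ka (bigD1 j) //= lerDl sumr_ge0.
  have cy : 0 < c j 0 / d j 0 * y j 0 by rewrite mulr_gt0// divr_gt0.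
  rewrite lerNl; apply: (@le_trans _ _ (d j 0 / (c j 0 * y j 0) * (2 * S * B + opt * t))).
    rewrite -(ler_pM2l cy) mulrN.
    have -> : c j 0 / d j 0 * y j 0 * (d j 0 / (c j 0 * y j 0) * (2 * S * B + opt * t)) =
        2 * S * B + opt * t by field; rewrite !gt_eqF.
    lra.
  rewrite (_ : ka * (2 * S * B) + ka * opt * t = ka * (2 * S * B + opt * t)); last by ring.
  rewrite ler_wpM2r//.
  by rewrite addr_ge0// !mulr_ge0.
pose al := ka * (2 * S * B); pose be := ka * opt.
have al0 : 0 <= al by rewrite /al !mulr_ge0.
have be0 : 0 <= be by rewrite /be mulr_ge0.
(* The competitor [y] has energy only on its support, where [Zlow] controls [1 / x_j]; clipping
   keeps that lower bound, which is nonpositive. *)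
have EM t : 0 <= t -> energy c (expv (w t)) (q t) <= M * expR (al + be * t).
  move=> t0; apply: le_trans (energy_min_energy_sol_le c0 (wpos t) (erefl (A *m y))) _.
  rewrite /energy /M mulr_suml; apply: ler_sum => j _.
  have [yj|yj] := eqVneq (y j 0) 0; first by rewrite yj expr0n /= !mulr0 mul0r.
  rewrite mulrAC ler_wpM2l// mxE -expRN ler_expR lerNl.
  have yj0 : 0 < y j 0 by rewrite lt_neqAle eq_sym yj y0.
  apply: clip_ge; last exact: Zlow.
  apply: le_trans (le_trans B0 (rB t t0)).
  by rewrite oppr_le0 addr_ge0// mulr_ge0.
move=> t i t0; rewrite ler_norml; apply/andP; split; last first.
  by apply: le_trans (ZB t i t0) _; rewrite lerDl !mulr_ge0// expR_ge0.
(* By [|u_i| <= K E] and [EM], no coordinate falls faster than [N exp(al + be t)] up to time [t]. *)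
have := mvt_ge t0 (Zc i) (fun s s0 _ => ZdE s s0 i) (k := - (N * expR (al + be * t))).
rewrite subr0 Z0 => /(_ _)-ZL.
have {}ZL : - (N * expR (al + be * t)) * t <= Z t i 0 - z0 i 0.
  apply: ZL => s s0 st.
  have e1 : expR (al + be * s) <= expR (al + be * t).
    by rewrite ler_expR lerD2l ler_wpM2l// ltW.
  have e2 : 1 <= expR (al + be * t).
    by rewrite -expR0 ler_expR addr_ge0// mulr_ge0.
  have Nle : d i 0 * (K * M / c i 0 + 1) <= N.
    by rewrite /N (bigD1 i) //= lerDl sumr_ge0.
  have := uK _ (wpos s) i; rewrite -/(q s) -/(u s) ler_norml => /andP[ul _].
  have KE : K * energy c (expv (w s)) (q s) <= K * M * expR (al + be * t).
    rewrite -mulrA ler_wpM2l//; apply: le_trans (EM s (ltW s0)) _.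
    by rewrite ler_wpM2l.
  rewrite lerNl; apply: le_trans (ler_wpM2r (expR_ge0 _) Nle).
  rewrite -mulrN -[leRHS]mulrA (ler_wpM2l (ltW (d0 i)))//.
  have h : - u s i 0 / c i 0 <= K * M * expR (al + be * t) / c i 0.
    by rewrite ler_pM2r ?invr_gt0//; lra.
  rewrite mulNr in h; rewrite mulrDl mul1r mulrAC; lra.
have := z0B i; rewrite ler_norml => /andP[z0l _].
rewrite -/al -/be; lra.
Qed.

End Existence.

(** * Existence of a global solution *)

Section ExistenceTheorem.
Context {R : realType} {n m : nat} (A : 'M[R]_(n, m)) (c d y x0 : 'cV[R]_m).
Hypotheses (c0 : pos_vec c) (d0 : pos_vec d) (y0 : forall i, 0 <= y i 0).
Local Notation V := 'cV[R]_m.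

Lemma dynamics_rhsE (b : 'cV[R]_n) (x : V) i :
  (diag_mx d^T *m (min_energy_sol A b c x - x)) i 0 =
  d i 0 * (min_energy_sol A b c x i 0 - x i 0).
Proof. by rewrite mul_diag_mx !mxE. Qed.

(** The clipping level [r] is itself the a priori bound, which holds for every level at least [B].
    So clipping is inactive along the solution, and [exp z] solves the original dynamics. *)
Theorem dynamics_solution_exists : pos_vec x0 ->
  exists x, dynamics_solution A (A *m y) c d x0 x.
Proof.
move=> x00; pose z0 : V := \col_i ln (x0 i 0).
have [B [al [be [N [B0 al0 be0 N0 apriori]]]]] := log_field_a_priori A c0 d0 y0 z0.
pose r (t : R) : R := B + N * `|t| * expR (al + be * `|t|).
have r0 (t : R) : 0 <= r t by rewrite addr_ge0// !mulr_ge0// expR_ge0.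
have rc : continuous r.
  move=> t; apply: cvgD; first exact: cvg_cst.
  have nc : `|s| @[s --> t] --> `|t| by apply: cvg_norm; exact: cvg_id.
  apply: cvgM; first by apply: cvgM => //; exact: cvg_cst.
  apply: (@continuous_comp _ _ _ (fun s => al + be * `|s|) expR t); last exact: continuous_expR.
  apply: cvgD; first exact: cvg_cst.
  by apply: cvgM => //; exact: cvg_cst.
have rnd (s t : R) : 0 <= s -> s <= t -> r s <= r t.
  move=> s_ge0 st; have t_ge0 := le_trans s_ge0 st.
  rewrite /r (ger0_norm s_ge0) (ger0_norm t_ge0) lerD2l.
  by apply: ler_pM; rewrite ?mulr_ge0 ?expR_ge0 ?ler_wpM2l ?ler_expR ?lerD2l ?ler_wpM2l.
have [z [zz0 zd]] := clipped_solution A y c0 d0 z0 rc r0 rnd.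
pose Z t := z (Num.max t 0).
have zr (t : R) i : 0 <= t -> `|z t i 0| <= r t.
  move=> t0; have -> : z t = Z t by rewrite /Z max_l.
  rewrite /r (ger0_norm t0); apply: (apriori Z r) => //.
  - move=> j; apply: (continuous_max0 (f := fun s => z s j 0)) => s s0.
    exact: derivable_continuous_at (zd s s0 j).
  - by rewrite /Z maxxx zz0.
  - by move=> s s0; rewrite lerDl !mulr_ge0// expR_ge0.
  - move=> s s0 j; apply: (is_derive_max0 (f := fun s => z s j 0)) => //.
    by rewrite /Z max_l ?(ltW s0)//; apply: zd; exact: ltW.
exists (fun t => expv (z t)); split.
- by apply/colP => i; rewrite zz0 !mxE lnK ?posrE.
- by move=> t _; exact: expv_gt0.
move=> t t0; apply: has_derivative_nneg_coord => i.
have := zd t t0 i; rewrite clip_id => [ztd|j]; last exact: zr.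
rewrite (_ : (fun s => _) = expR \o (fun s => z s i 0)); last first.
  by apply/funext => s; rewrite mxE.
rewrite dynamics_rhsE.
(* Chain rule for [x = exp z]: [x_i d_i (u_i / c_i - 1) = d_i (q_i - x_i)]. *)
have -> : d i 0 * (min_energy_sol A (A *m y) c (expv (z t)) i 0 - expv (z t) i 0) =
    expR (z t i 0) * log_field A c d y (z t) i 0.
  rewrite [log_field _ _ _ _ _ _ _]mxE [tension _ _ _ _ _]mxE ![expv _ _ _]mxE.
  by field; rewrite !gt_eqF ?expR_gt0.
exact: is_derive1_comp.
Qed.

End ExistenceTheorem.

(** * From restricted difference quotients to ordinary derivatives *)

Section OneSidedDerivative.
Context {R : realType} {m : nat}.

Lemma has_derivative_nneg_quotient (x : R -> 'cV[R]_m) (t e : R) (v : 'cV[R]_m) i :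
  has_derivative_nneg x t v -> 0 < e -> exists2 de : R, 0 < de &
    forall h, `|h| < de -> h != 0 -> 0 <= t + h ->
      `|v i 0 - h^-1 * (x (t + h) i 0 - x t i 0)| < e.
Proof.
move=> xv e0.
have : \forall h \near (0 : R), h != 0 -> 0 <= t + h ->
    `|v - h^-1 *: (x (t + h) - x t)| < e.
  exact: (@cvgrPdist_lt _ _ _ (within [set h | 0 <= t + h] 0^') _ _ _).1 xv e e0.
move=> /nbhs_ballP[de /= de0 H]; exists de => // h hde h0 th.
have := H h; rewrite /ball /= sub0r normrN => /(_ hde h0 th).
apply: le_lt_trans; have := coord_le_norm (v - h^-1 *: (x (t + h) - x t)) i.
by rewrite !mxE.
Qed.

Lemma has_derivative_nneg_continuous (x : R -> 'cV[R]_m) (v : R -> 'cV[R]_m) i :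
  (forall t, 0 <= t -> has_derivative_nneg x t (v t)) ->
  continuous (fun t : R => x (Num.max t 0) i 0).
Proof.
move=> xv; rewrite (_ : (fun t => _) =
    (fun t => x (Num.max (Num.max t 0) 0) i 0)); last first.
  by apply/funext => t; rewrite -maxA maxxx.
apply: (continuous_max0 (f := fun t => x (Num.max t 0) i 0)) => t t0.
have [de de0 H] := has_derivative_nneg_quotient i (xv t t0) ltr01.
apply/(@cvgrPdist_lt _ _ _ (nbhs t)) => e e0.
pose M := `|v t i 0| + 1; have M0 : 0 < M by rewrite ltr_wpDl.
have me0 : 0 < Num.min de (e / M) by rewrite lt_min de0 divr_gt0.
near=> s.
have : `|t - s| < Num.min de (e / M).
  by near: s; exact: (@cvgr_dist_lt _ _ _ (nbhs t) _ id t (@cvg_id _ _) _ me0).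
rewrite lt_min => /andP[s1 s2].
(* Freezing at 0 moves [s] no farther from [t], and quotients near [t] are bounded by [M]. *)
rewrite (max_l t0); set s' := Num.max s 0.
have s'0 : 0 <= s' by rewrite le_max lexx orbT.
have hs : `|s' - t| <= `|t - s|.
  rewrite /s'; case: (leP s 0) => s0; last by rewrite distrC.
  by rewrite sub0r normrN !ger0_norm; lra.
have [->|st] := eqVneq s' t; first by rewrite subrr normr0.
have h0 : s' - t != 0 by rewrite subr_eq0.
have := H (s' - t) (le_lt_trans hs s1) h0; rewrite addrC subrK => /(_ s'0) hq.
rewrite distrC; have -> : x s' i 0 - x t i 0 =
    (s' - t) * ((s' - t)^-1 * (x s' i 0 - x t i 0)) by rewrite mulVKf.
rewrite normrM; apply: (@le_lt_trans _ _ (`|t - s| * M)).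
  apply: ler_pM => //; rewrite /M.
  have := ler_normB (v t i 0) (v t i 0 - (s' - t)^-1 * (x s' i 0 - x t i 0)).
  rewrite opprB addrC subrK; lra.
by rewrite -ltr_pdivlMr.
Unshelve. all: by end_near.
Qed.

Lemma has_derivative_nneg_is_derive (x : R -> 'cV[R]_m) (v : 'cV[R]_m) (t : R) i :
  0 < t -> has_derivative_nneg x t v ->
  is_derive t (1 : R) (fun s => x (Num.max s 0) i 0) (v i 0).
Proof.
move=> t0 xv; apply: (is_derive_max0 (f := fun s => x s i 0)) => //.
have : h^-1 *: (x (h *: (1 : R) + t) i 0 - x t i 0) @[h --> 0^'] --> v i 0.
  apply/cvgrPdist_lt => e e0.
  have [de de0 H] := has_derivative_nneg_quotient i xv e0.
  (* For [|h| < t] the constraint [0 <= t + h] is automatic. *)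
  have m0 : 0 < Num.min de t by rewrite lt_min de0.
  apply/nbhs_ballP; exists (Num.min de t) => //= h.
  rewrite /ball /= sub0r normrN lt_min => /andP[h1 h2] h0.
  rewrite /GRing.scale /= mulr1 [h + t]addrC; apply: H => //.
  by move: h2; rewrite ltr_norml => /andP[]; lra.
move=> xd; have xc : derivable (fun s => x s i 0) t 1 by apply/cvg_ex; exists (v i 0).
by apply: DeriveDef => //; exact: cvg_lim xd.
Qed.

End OneSidedDerivative.

(** * Residuals and the distance to the feasible set *)

Section FeasibleDistance.
Context {R : realType} {n m : nat} (A : 'M[R]_(n, m)) (b : 'cV[R]_n).

Lemma eucl_norm_ltP (v : 'cV[R]_m) (e : R) : 0 < e ->
  (eucl_norm v < e) = (\sum_i v i 0 ^+ 2 < e ^+ 2).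
Proof.
move=> e0; have s0 : 0 <= \sum_i v i 0 ^+ 2 by apply: sumr_ge0 => i _; exact: sqr_ge0.
by rewrite -[in RHS](sqr_sqrtr s0) ltr_sqr ?nnegrE ?sqrtr_ge0// ltW.
Qed.

Lemma continuous_residual (T : topologicalType) (f : 'I_m -> T -> R) :
  (forall i, continuous (f i)) ->
  continuous (fun v => \sum_k `|b k 0 - \sum_i A k i * f i v|).
Proof.
move=> fc v; apply: cvg_sum_ord => k; apply: cvg_norm; apply: cvgB; first exact: cvg_cst.
by apply: cvg_sum_ord => i; apply: cvgM; [exact: cvg_cst|exact: fc].
Qed.

Lemma continuous_sqdist (T : topologicalType) (z : 'cV[R]_m) (f : 'I_m -> T -> R) :
  (forall i, continuous (f i)) ->
  continuous (fun v => \sum_i (f i v - z i 0) ^+ 2).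
Proof.
move=> fc v; apply: cvg_sum_ord => i; rewrite expr2.
by apply: cvgM; apply: cvgB; (exact: fc || exact: cvg_cst).
Qed.

(* Compactness is used on row vectors, the case covered by [rV_compact]. *)
Lemma feasible_error_bound (U e : R) : 0 < e -> exists2 de : R, 0 < de &
  forall x : 'cV[R]_m, (forall i, 0 <= x i 0 <= U) ->
    \sum_k `|b k 0 - (A *m x) k 0| < de ->
    exists2 z, feasible A b z & eucl_norm (x - z) < e.
Proof.
move=> e0.
pose F (v : 'rV[R]_m) : R := \sum_k `|b k 0 - \sum_i A k i * v 0 i|.
pose g (z : 'cV[R]_m) (v : 'rV[R]_m) : R := \sum_i (v 0 i - z i 0) ^+ 2.
have Fc : continuous F.
  exact: (continuous_residual (fun i => @coord_continuous R 1 m 0 i)).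
have gc z : continuous (g z).
  apply: (@continuous_sqdist _ z (fun i (v : 'rV[R]_m) => v 0 i)) => i.
  exact: coord_continuous.
pose box : set 'rV[R]_m := [set v | forall i, `[0, U]%classic (v 0 i)].
(* Points of the box at distance at least [e] from every feasible point. The residual [F] is
   positive on this compact set, and its minimum there serves as [de]. *)
pose K := box `&` \bigcap_(z in feasible A b) (g z @^-1` [set r | e ^+ 2 <= r]).
have boxc : compact box.
  by apply: (@rV_compact _ _ (fun=> `[0, U]%classic)) => _; exact: segment_compact.
have Kc : compact K.
  apply: (subclosed_compact _ boxc); last by move=> v [].
  apply: closedI; first exact: compact_closed boxc.
  apply: closed_bigI => z _; apply: preimage_closed; last exact: closed_ge.
  by move=> v _; exact: gc.
have FE (x : 'cV[R]_m) : F x^T = \sum_k `|b k 0 - (A *m x) k 0|.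
  apply: eq_bigr => k _; rewrite mxE; congr (`|_ - _|).
  by apply: eq_bigr => i _; rewrite mxE.
have out (x : 'cV[R]_m) : (forall i, 0 <= x i 0 <= U) -> ~ K x^T ->
    exists2 z, feasible A b z & eucl_norm (x - z) < e.
  move=> xU xK; apply: contrapT => nz; apply: xK; split.
    by move=> i /=; rewrite mxE in_itv /=.
  move=> z zf /=; rewrite leNgt; apply/negP => gz; apply: nz; exists z => //.
  rewrite eucl_norm_ltP//; apply: le_lt_trans gz; rewrite le_eqVlt; apply/orP; left.
  by apply/eqP; apply: eq_bigr => i _; rewrite !mxE.
have [K0|/set0P Kn0] := eqVneq K set0.
  by exists 1 => // x xU _; apply: out => //; rewrite K0.
have [v] := compact_EVT_min Kn0 Kc (continuous_subspaceT Fc).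
rewrite inE => -[vU vK] vmin.
exists (F v) => [|x xU xv]; last first.
  apply: out => // xK; have := vmin x^T; rewrite inE => /(_ xK).
  by rewrite FE leNgt xv.
rewrite lt_neqAle eq_sym; apply/andP; split; last by apply: sumr_ge0.
(* A zero of [F] in the box is feasible, hence at distance 0 from itself and outside [K]. *)
apply/eqP => /eqP; rewrite psumr_eq0// => /allP Fv0.
have vf : feasible A b v^T.
  split=> [|i]; last by rewrite mxE; have := vU i; rewrite /= in_itv /= => /andP[].
  apply/colP => k; have := Fv0 k (mem_index_enum _).
  rewrite /= normr_eq0 subr_eq0 => /eqP ->; rewrite mxE.
  by apply: eq_bigr => i _; rewrite mxE.
have := vK _ vf; rewrite /= /g big1 => [|i _]; last by rewrite mxE subrr expr0n.
by rewrite leNgt exprn_gt0.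
Qed.

Lemma dist_ge0 (x : 'cV[R]_m) : feasible A b !=set0 -> 0 <= dist x (feasible A b).
Proof.
move=> [z zf]; apply: lb_le_inf; first by exists (eucl_norm (x - z)); exists z.
by move=> _ [w _ <-]; exact: sqrtr_ge0.
Qed.

Lemma dist_le (x z : 'cV[R]_m) : feasible A b z ->
  dist x (feasible A b) <= eucl_norm (x - z).
Proof.
move=> zf; apply: ge_inf; last by exists z.
by exists 0 => _ [w _ <-]; exact: sqrtr_ge0.
Qed.

End FeasibleDistance.

(** * Lyapunov functional and long-time behaviour *)

Section Asymptotics.
Context {R : realType} {n m : nat} (A : 'M[R]_(n, m)) (c d y : 'cV[R]_m) (p : 'cV[R]_n).
Local Notation V := 'cV[R]_m.
Variable X : R -> V.
Let q t := min_energy_sol A (A *m y) c (X t).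
Let rho := A^T *m p.
Hypotheses (c0 : pos_vec c) (d0 : pos_vec d) (y0 : forall i, 0 <= y i 0).
Hypotheses (rho_le : forall i, rho i 0 <= c i 0) (rho_y : dotv p (A *m y) = dotv c y).
Hypotheses (X0 : forall t, pos_vec (X t)) (Xc : forall i, continuous (fun t => X t i 0)).
Hypothesis Xd : forall t : R, 0 < t -> forall i,
  is_derive t (1 : R) (fun s => X s i 0) (d i 0 * (q t i 0 - X t i 0)).

Let W t : R := \sum_i (d i 0)^-1 *
  (c i 0 * y i 0 * ln (X t i 0) - (2 * c i 0 - rho i 0) * X t i 0).
Let slack t : R := \sum_i (c i 0 - rho i 0) * X t i 0.
Let dissipation t : R :=
  \sum_i c i 0 / X t i 0 * (q t i 0 - X t i 0) ^+ 2 + slack t.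

Lemma lyapunov_continuous : continuous W.
Proof.
apply: continuous_sumZ => i t; apply: cvgB; apply: cvgM; try exact: cvg_cst.
  apply: (@continuous_comp _ _ _ (fun t => X t i 0) (@ln R) t); first exact: Xc.
  exact: continuous_ln (X0 t i).
exact: Xc.
Qed.

Lemma lyapunov_derive (t : R) : 0 < t -> is_derive t (1 : R) W (dissipation t).
Proof.
move=> t0.
have [Aq _] := min_energy_solP A c0 y (X0 t).
have E1 : \sum_i c i 0 / X t i 0 * q t i 0 * y i 0 =
          \sum_i c i 0 / X t i 0 * q t i 0 ^+ 2.
  have := energy_min_energy_sol c0 (X0 t) (erefl (A *m y)).
  by rewrite /energy /dotv => ->; apply: eq_bigr => i _; rewrite mxE.
have E2 : \sum_i rho i 0 * q t i 0 = \sum_i c i 0 * y i 0.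
  by rewrite -/(dotv rho (q t)) -/(dotv c y) dotv_trmul Aq rho_y.
have -> : dissipation t = \sum_i (d i 0)^-1 *
    (c i 0 * y i 0 * ((X t i 0)^-1 * (d i 0 * (q t i 0 - X t i 0))) -
     (2 * c i 0 - rho i 0) * (d i 0 * (q t i 0 - X t i 0))).
  apply/eqP; rewrite -subr_eq0; apply/eqP.
  (* [E1] is the pairing of the tension with [y], [E2] is [p . A q = p . A y = c . y]. Their sum
     accounts, coordinate by coordinate, for the gap between the dissipation and the raw
     derivative. *)
  have E12 := congr2 (fun a b : R => a + b) (esym E1) (esym E2).
  move/eqP: E12; rewrite -subr_eq0 => /eqP E12.
  rewrite -[RHS]E12 /dissipation /slack.
  rewrite -!big_split -!sumrB /=; apply: eq_bigr => i _.
  by field; rewrite !gt_eqF//; exact: X0.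
apply: is_derive_sumZ => i; apply: is_deriveB.
  have lnd := is_derive1_comp (is_derive1_ln (X0 t i)) (Xd t0 i).
  exact: (is_deriveZ (c i 0 * y i 0) lnd).
exact: (is_deriveZ (2 * c i 0 - rho i 0) (Xd t0 i)).
Qed.

Lemma slack_ge0 t : 0 <= slack t.
Proof.
apply: sumr_ge0 => i _; rewrite mulr_ge0 ?subr_ge0//; exact: ltW (X0 t i).
Qed.

Lemma flow_term_ge0 t i : 0 <= c i 0 / X t i 0 * (q t i 0 - X t i 0) ^+ 2.
Proof. by rewrite mulr_ge0 ?sqr_ge0// divr_ge0// ltW//; exact: X0. Qed.

Lemma slack_le_dissipation t : slack t <= dissipation t.
Proof. by rewrite lerDr sumr_ge0// => i _; exact: flow_term_ge0. Qed.

Lemma dissipation_ge0 t : 0 <= dissipation t.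
Proof. exact: le_trans (slack_ge0 t) (slack_le_dissipation t). Qed.

(** Once [x_i] exceeds the uniform flow bound [Q], its derivative is nonpositive. *)
Lemma trajectory_bounded : exists2 U : R, 1 <= U &
  forall t i, 0 <= t -> X t i 0 <= U /\ `|q t i 0| <= U.
Proof.
have [Q Q0 qQ] := min_energy_sol_bounded A y c0.
exists (`|X 0| + Q + 1) => [|t i t0]; first by rewrite lerDr addr_ge0// ltW.
split; last by apply: le_trans (qQ _ (X0 t) i) _; have := normr_ge0 (X 0); lra.
apply: (barrier_le (@Xc i) (df := fun t => d i 0 * (q t i 0 - X t i 0))) => //
    [{}t {}t0||{}t {}t0 Bt]; first exact: Xd.
  by have := ler_norm (X 0 i 0); have := coord_le_norm (X 0) i; lra.
rewrite pmulr_rle0// subr_le0; apply: le_trans (ler_norm _) _.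
by apply: le_trans (qQ _ (X0 t) i) _; have := normr_ge0 (X 0); lra.
Qed.

(** As [2 c - rho >= c > 0], the linear terms only lower the sum. [P] is full when bounding [W] and
    omits one index when isolating a coordinate. *)
Lemma lyapunov_le (U t : R) (P : pred 'I_m) : 1 <= U -> (forall i, X t i 0 <= U) ->
  \sum_(i | P i) (d i 0)^-1 *
    (c i 0 * y i 0 * ln (X t i 0) - (2 * c i 0 - rho i 0) * X t i 0) <=
  \sum_i (d i 0)^-1 * (c i 0 * y i 0 * ln U).
Proof.
move=> U1 XU.
have di i : 0 <= (d i 0)^-1 by rewrite invr_ge0 ltW.
have cy i : 0 <= c i 0 * y i 0 by rewrite mulr_ge0// ltW.
have lnU : 0 <= ln U by exact: ln_ge0.
apply: (@le_trans _ _ (\sum_(i | P i) (d i 0)^-1 * (c i 0 * y i 0 * ln U))).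
  apply: ler_sum => i _; rewrite ler_wpM2l//.
  have : 0 <= (2 * c i 0 - rho i 0) * X t i 0.
    apply: mulr_ge0; last exact: ltW (X0 t i).
    by have := rho_le i; have := c0 i; lra.
  have : c i 0 * y i 0 * ln (X t i 0) <= c i 0 * y i 0 * ln U.
    rewrite ler_wpM2l// ler_ln ?posrE//; first exact: X0.
    exact: lt_le_trans ltr01 U1.
  lra.
rewrite [leRHS](bigID P) /= lerDl sumr_ge0// => i _.
exact: mulr_ge0 (di i) (mulr_ge0 (cy i) lnU).
Qed.

Lemma lyapunov_ge (t : R) : 0 <= t -> W 0 <= W t.
Proof.
move=> t0; suff : 0 * (t - 0) <= W t - W 0 by rewrite mul0r subr_ge0.
apply: (mvt_ge (df := dissipation)) => //; first exact: lyapunov_continuous.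
  by move=> s s0 _; exact: lyapunov_derive.
by move=> s _ _; exact: dissipation_ge0.
Qed.

(** [W] never falls below [W 0], while the summands other than [j] total at most [S]; this bounds
    [ln x_j] from below. *)
Lemma trajectory_lower_bound j : 0 < y j 0 ->
  exists2 e : R, 0 < e & forall t, 0 <= t -> e <= X t j 0.
Proof.
move=> yj; have [U U1 XU] := trajectory_bounded.
pose S := \sum_i (d i 0)^-1 * (c i 0 * y i 0 * ln U).
have k0 : 0 < (d j 0)^-1 * (c j 0 * y j 0) by rewrite !mulr_gt0 ?invr_gt0.
exists (expR ((W 0 - S) / ((d j 0)^-1 * (c j 0 * y j 0)))) => [|t t0].
  exact: expR_gt0.
rewrite -[leRHS]lnK ?posrE; last exact: X0.
rewrite ler_expR ler_pdivrMr//.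
have := lyapunov_ge t0; rewrite {2}/W (bigD1 j) //= => Wt.
have := @lyapunov_le U t (fun i => i != j) U1 (fun i => (XU t i t0).1).
rewrite -/S => St.
have : 0 <= (d j 0)^-1 * ((2 * c j 0 - rho j 0) * X t j 0).
  apply: mulr_ge0; first by rewrite invr_ge0 ltW.
  apply: mulr_ge0; last exact: ltW (X0 t j).
  by have := rho_le j; have := c0 j; lra.
lra.
Qed.

Lemma trajectory_lipschitz (a : V) : exists L : R, forall s t : R,
  0 <= s -> s <= t ->
  `|\sum_i a i 0 * X t i 0 - \sum_i a i 0 * X s i 0| <= L * (t - s).
Proof.
have [U U1 XU] := trajectory_bounded.
have ac : continuous (fun t => \sum_i a i 0 * X t i 0) by exact: continuous_sumZ.
pose L := \sum_i `|a i 0| * (d i 0 * (U + U)).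
have dL (t : R) : 0 <= t ->
    `|\sum_i a i 0 * (d i 0 * (q t i 0 - X t i 0))| <= L.
  move=> t0; apply: le_trans (ler_norm_sum _ _ _) _; apply: ler_sum => i _.
  rewrite !normrM ler_wpM2l// (gtr0_norm (d0 i)) (ler_wpM2l (ltW (d0 i)))//.
  apply: le_trans (ler_normB _ _) _; have [X1 X2] := XU t i t0.
  by rewrite lerD// gtr0_norm//; exact: X0.
have ad (t : R) : 0 < t -> is_derive t (1 : R) (fun t => \sum_i a i 0 * X t i 0)
    (\sum_i a i 0 * (d i 0 * (q t i 0 - X t i 0))).
  by move=> t0; apply: is_derive_sumZ => i; exact: Xd.
exists L => s t s0 st; rewrite ler_norml -mulNr; apply/andP; split.
  apply: (mvt_ge st ac (fun r sr _ => ad r (le_lt_trans s0 sr))) => r sr rt.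
  have r0 : 0 <= r by lra.
  by have := dL r r0; rewrite ler_norml => /andP[].
apply: (mvt_le st ac (fun r sr _ => ad r (le_lt_trans s0 sr))) => r sr rt.
have r0 : 0 <= r by lra.
by have := dL r r0; rewrite ler_norml => /andP[].
Qed.

Lemma dissipation_cvg0 (f : R -> R) (L : R) :
  (forall s t : R, 0 <= s -> s <= t -> `|f t - f s| <= L * (t - s)) ->
  (forall e : R, 0 < e -> exists2 eta : R, 0 < eta &
     forall t : R, 0 < t -> e <= `|f t| -> eta <= dissipation t) ->
  f t @[t --> +oo] --> (0 : R).
Proof.
move=> fL fe; have [U U1 XU] := trajectory_bounded.
apply: (lipschitz_dissipation_cvg0 lyapunov_continuous lyapunov_derive _ _ fL fe).
  by move=> t _; exact: dissipation_ge0.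
by move=> t t0; apply: (lyapunov_le xpredT U1) => i; exact: (XU t i t0).1.
Qed.

Lemma slack_cvg0 : slack t @[t --> +oo] --> (0 : R).
Proof.
have [L HL] := trajectory_lipschitz (c - rho).
have sE t : slack t = \sum_i (c - rho) i 0 * X t i 0.
  by apply: eq_bigr => i _; rewrite [(c - rho) i 0]mxE [(- rho) i 0]mxE.
apply: (dissipation_cvg0 (L := L)) => [s t s0 st|e e0].
  by rewrite !sE; exact: HL.
exists e => // t _; rewrite ger0_norm ?slack_ge0// => /le_trans; apply.
exact: slack_le_dissipation.
Qed.

(** Since [A q = A y], the residual is [A_k . (q - x)], and a weighted Cauchy-Schwarz inequality
    bounds its square by [M] times the dissipation, [x] being at most [U]. *)
Lemma residual_cvg0 k : (A *m y) k 0 - (A *m X t) k 0 @[t --> +oo] --> (0 : R).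
Proof.
have [U U1 XU] := trajectory_bounded.
have [L HL] := trajectory_lipschitz (\col_i A k i).
have AXE t : (A *m X t) k 0 = \sum_i (\col_i A k i : V) i 0 * X t i 0.
  by rewrite mxE; apply: eq_bigr => i _; rewrite mxE.
pose M := \sum_i A k i ^+ 2 * U / c i 0 + 1.
have M0 : 0 < M.
  rewrite ltr_wpDl// sumr_ge0// => i _.
  by rewrite mulr_ge0 ?invr_ge0 ?(ltW (c0 i))// mulr_ge0 ?sqr_ge0//; lra.
apply: (dissipation_cvg0 (L := L)) => [s t s0 st|e e0].
  by rewrite !AXE opprB addrC addrA subrK distrC; exact: HL.
exists (e ^+ 2 / M) => [|t t0 er]; first by rewrite divr_gt0// exprn_gt0.
have [Aq _] := min_energy_solP A c0 y (X0 t).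
set r := (A *m y) k 0 - (A *m X t) k 0 in er.
have rE : r = \sum_i A k i * (q t i 0 - X t i 0).
  rewrite /r -Aq -/(q t) !mxE -sumrB; apply: eq_bigr => i _; ring.
apply: (@le_trans _ _ (r ^+ 2 / M)).
  rewrite ler_pM2r ?invr_gt0// -[leRHS](real_normK (num_real _)) ler_sqr ?nnegrE//; exact: ltW.
(* Expand [sum (c/X) (q - X - l A_k X/c)^2 >= 0] at the optimal [l = r/M]. *)
have key (l : R) : 2 * l * r - l ^+ 2 * M <= dissipation t.
  apply: (@le_trans _ _ (\sum_i c i 0 / X t i 0 * (q t i 0 - X t i 0) ^+ 2)); last first.
    by rewrite lerDl slack_ge0.
  apply: (@le_trans _ _ (\sum_i (2 * l * (A k i * (q t i 0 - X t i 0)) -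
      l ^+ 2 * (A k i ^+ 2 * X t i 0 / c i 0)))).
    rewrite sumrB -!mulr_sumr -rE lerD2l lerN2 ler_wpM2l ?sqr_ge0//.
    rewrite /M ler_wpDr//; apply: ler_sum => i _.
    rewrite ler_wpM2r ?invr_ge0 ?(ltW (c0 i))// ler_wpM2l ?sqr_ge0//.
    exact: (XU t i (ltW t0)).1.
  apply: ler_sum => i _; rewrite -subr_ge0.
  have -> : c i 0 / X t i 0 * (q t i 0 - X t i 0) ^+ 2 -
      (2 * l * (A k i * (q t i 0 - X t i 0)) - l ^+ 2 * (A k i ^+ 2 * X t i 0 / c i 0)) =
      c i 0 / X t i 0 * (q t i 0 - X t i 0 - l * A k i * X t i 0 / c i 0) ^+ 2.
    by field; rewrite !gt_eqF//; exact: X0.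
  by rewrite mulr_ge0 ?sqr_ge0// divr_ge0// ltW//; exact: X0.
have := key (r / M); apply: le_trans.
by rewrite (_ : 2 * (r / M) * r - _ = r ^+ 2 / M)//; field; rewrite gt_eqF.
Qed.

(** In [c . x = c . y + slack - p . (A y - A x)] the last two terms tend to 0. *)
Lemma cost_cvg : dotv c (X t) @[t --> +oo] --> dotv c y.
Proof.
have cE t : dotv c (X t) =
    dotv c y + slack t - \sum_k p k 0 * ((A *m y) k 0 - (A *m X t) k 0).
  have -> : \sum_k p k 0 * ((A *m y) k 0 - (A *m X t) k 0) =
      dotv c y - \sum_i rho i 0 * X t i 0.
    rewrite -rho_y -/(dotv rho (X t)) dotv_trmul /dotv -sumrB.
    by apply: eq_bigr => k _; rewrite mulrBr.
  rewrite opprB addrA [_ + slack t]addrC -!addrA [dotv c y + _]addrC subrK.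
  by rewrite /slack /dotv -big_split /=; apply: eq_bigr => i _; ring.
rewrite (_ : (fun t => _) = fun t => dotv c y + slack t -
    \sum_k p k 0 * ((A *m y) k 0 - (A *m X t) k 0)); last by apply/funext.
have : dotv c y + slack t - \sum_k p k 0 * ((A *m y) k 0 - (A *m X t) k 0)
    @[t --> +oo] --> dotv c y + 0 - \sum_(k < n) p k 0 * 0.
  apply: cvgB; first by apply: cvgD; [exact: cvg_cst|exact: slack_cvg0].
  by apply: cvg_sum_ord => k; apply: cvgM; [exact: cvg_cst|exact: residual_cvg0].
rewrite (_ : \sum_(k < n) p k 0 * 0 = 0) ?addr0 ?subr0//.
by rewrite big1// => k _; rewrite mulr0.
Qed.

Lemma dist_feasible_cvg0 : dist (X t) (feasible A (A *m y)) @[t --> +oo] --> (0 : R).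
Proof.
have [U U1 XU] := trajectory_bounded.
apply/cvgrPdist_lt => e e0.
have [de de0 H] := feasible_error_bound A (A *m y) U e0.
have : \sum_k `|(A *m y) k 0 - (A *m X t) k 0| @[t --> +oo] -->
    \sum_(k < n) `|0 : R|.
  by apply: cvg_sum_ord => k; apply: cvg_norm; exact: residual_cvg0.
rewrite [X in _ --> X -> _]big1 => [|k _]; last by rewrite normr0.
move=> /cvgrPdist_lt/(_ _ de0) near_res.
near=> t.
have t0 : 0 <= t by near: t; exact: nbhs_pinfty_ge.
have Fy : feasible A (A *m y) !=set0 by exists y; split.
rewrite sub0r normrN ger0_norm ?dist_ge0//.
have XtU i : 0 <= X t i 0 <= U by rewrite (ltW (X0 t i)) (XU t i t0).1.
have rt : \sum_k `|(A *m y) k 0 - (A *m X t) k 0| < de.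
  have : `|0 - \sum_k `|(A *m y) k 0 - (A *m X t) k 0| | < de by near: t.
  by rewrite sub0r normrN; apply: le_lt_trans; exact: ler_norm.
have [z zf] := H (X t) XtU rt.
by apply: le_lt_trans; exact: dist_le.
Unshelve. all: by end_near.
Qed.

End Asymptotics.

(** * Existence, and asymptotics of an arbitrary solution *)

Unset Implicit Arguments.

Theorem theorem2 (R : realType) (n m : nat) (A : 'M[R]_(n, m)) (b : 'cV[R]_n)
    (c : 'cV[R]_m) (c_gt0 : pos_vec c)
    (feas : feasible A b !=set0)
    (xstar : 'cV[R]_m) (xstar_opt : optimal A b c xstar)
    (I_neq0 : opt_support A b c !=set0)
    (d : 'cV[R]_m) (d_gt0 : pos_vec d)
    (x0 : 'cV[R]_m) (x0_gt0 : pos_vec x0) :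
  (exists x : R -> 'cV[R]_m, dynamics_solution A b c d x0 x) /\
  (forall x : R -> 'cV[R]_m, dynamics_solution A b c d x0 x ->
    [/\ forall i : 'I_m, opt_support A b c i ->
          0 < inf [set x t i 0 | t in [set t : R | 0 <= t]],
        dist (x t) (feasible A b) @[t --> +oo] --> (0 : R) &
        dotv c (x t) @[t --> +oo] --> dotv c xstar]).
Proof.
split.
  have [[Ax xs0] _] := xstar_opt.
  by rewrite -Ax; exact: dynamics_solution_exists.
move=> x [x_0 x_gt0 x_deriv].
(* Freezing at 0 makes the trajectory continuous and positive on all of [R] and leaves limits at
   infinity unchanged. *)
pose X (t : R) := x (Num.max t 0).
have XE t : 0 <= t -> X t = x t by move=> t0; rewrite /X max_l.
have X_gt0 t : pos_vec (X t) by apply: x_gt0; rewrite le_max lexx orbT.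
have Xc i : continuous (fun t => X t i 0).
  by apply: has_derivative_nneg_continuous => t; exact: x_deriv.
have Xd (t : R) : 0 < t -> forall i, is_derive t (1 : R) (fun s => X s i 0)
    (d i 0 * (min_energy_sol A b c (X t) i 0 - X t i 0)).
  move=> t0 i; rewrite (XE t (ltW t0)) -dynamics_rhsE.
  by apply: has_derivative_nneg_is_derive => //; apply: x_deriv; exact: ltW.
have xX (f : 'cV[R]_m -> R) (l : R) :
    f (X t) @[t --> +oo] --> l -> f (x t) @[t --> +oo] --> l.
  apply: cvg_trans; apply: near_eq_cvg.
  have : \forall t \near +oo, (0 : R) <= t by exact: nbhs_pinfty_ge.
  by apply: filterS => t t0; rewrite XE.
have [[Ax xs0] _] := xstar_opt.
have [p [p_le p_opt]] := lp_dual_certificate c_gt0 xstar_opt.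
split.
(* Each [i] uses an optimal [y] with [y_i > 0] and the dual certificate of that [y], with [b]
   rewritten as [A y]. *)
- move=> i [y y_opt] /= yi; have [[Ay y0] _] := y_opt.
  have [p' [p'_le p'_opt]] := lp_dual_certificate c_gt0 y_opt.
  have yi0 : 0 < y i 0 by rewrite lt_neqAle eq_sym yi y0.
  rewrite -Ay in Xd p'_opt.
  have [e e0 eX] := trajectory_lower_bound c_gt0 d_gt0 y0 p'_le p'_opt X_gt0 Xc Xd yi0.
  apply: lt_le_trans e0 _; apply: lb_le_inf; first by exists (x 0 i 0); exists 0 => /=.
  by move=> _ [t /= t0 <-]; rewrite -XE//; exact: eX.
- apply: (xX (fun v => dist v _)); rewrite -Ax in Xd p_opt *.
  exact: (dist_feasible_cvg0 c_gt0 d_gt0 xs0 p_le p_opt X_gt0 Xc Xd).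
- apply: xX; rewrite -Ax in Xd p_opt.
  exact: (cost_cvg c_gt0 d_gt0 xs0 p_le p_opt X_gt0 Xc Xd).
Qed.
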